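(* Let $i,j\in\{0,1,2,3\}$, and consider the twisted spinor bundle $S\oplus S=S\otimes\mathbb C^2$ with charge conjugation $C\otimes\tau_i$. A (non-zero) $\ell$-form $F$ contributes to an admissible connection in the form $\frac1{\ell!}F_{\kappa_1\ldots\kappa_\ell}\gamma^{\kappa_1\cdots\kappa_\ell}\gamma_\mu\otimes\tau_j$ (i.e. the connection $D_\mu=\nabla_\mu+\frac1{\ell!}F_{\kappa_1\ldots\kappa_\ell}\gamma^{\kappa_1\cdots\kappa_\ell}\gamma_\mu\otimes\tau_j$ is admissible) if and only if $$\Delta_\ell\Delta_1\,\varepsilon_j\,\varepsilon_{ij}=-1.$$ All possible values of $(\ell,i,j)$ are the following. If $\ell\equiv1\bmod 4$ or $\ell\equiv1-\Delta_0\Delta_1\bmod 4$: $j=2$ for $i=0$; $j=3$ for $i=1$; $j\in\{1,2,3\}$ for $i=2$; $j=1$ for $i=3$. If $\ell\equiv3\bmod4$ or $\ell\equiv1+\Delta_0\Delta_1\bmod4$: $j\in\{0,1,3\}$ for $i=0$; $j\in\{0,1,2\}$ for $i=1$; $j=0$ for $i=2$; $j\in\{0,2,3\}$ for $i=3$.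
   Context: $(M,g)$ is a (pseudo-)Riemannian spin manifold with Levi-Civita connection $\nabla$ (also on the spinor bundle $S$) and Clifford multiplication $\gamma$, $\gamma(X)\gamma(Y)+\gamma(Y)\gamma(X)=-2g(X,Y)$; $\gamma_\mu=\gamma(e_\mu)$, and $\gamma_{\mu_1\cdots\mu_k}$ is the skew-symmetrization (weight one) of $\gamma_{\mu_1}\cdots\gamma_{\mu_k}$. $C$ is a fixed charge conjugation on $S$: a non-degenerate spin-invariant bilinear form. The signs $\Delta_k\in\{\pm1\}$ are defined by $C(\phi,\gamma_{\mu_1\cdots\mu_k}\psi)=\Delta_kC(\psi,\gamma_{\mu_1\cdots\mu_k}\phi)$; one has $\Delta_k=(-1)^{k(k-1)/2}\Delta_0^{k+1}\Delta_1^k$. Modified Pauli matrices: $\tau_0=\begin{pmatrix}1&0\\0&1\end{pmatrix}$, $\tau_1=\begin{pmatrix}0&1\\1&0\end{pmatrix}$, $\tau_2=\begin{pmatrix}0&1\\-1&0\end{pmatrix}$, $\tau_3=\begin{pmatrix}1&0\\0&-1\end{pmatrix}$. The signs $\varepsilon_{ij}$, $\varepsilon_j$ are defined by $\tau_i\tau_j=\varepsilon_{ij}\tau_j\tau_i$ and $\tau_j^T=\varepsilon_j\tau_j$. On $S\oplus S$ the charge conjugation is $(C\otimes\tau_i)(\eta,\xi)=\sum_{a,b}(\tau_i)_{ab}C(\eta_a,\xi_b)$; $\gamma$ acts on $S\oplus S$ as $\gamma\otimes\mathbb 1$, and $\nabla$ acts componentwise. For an endomorphism $\Phi$ of $S\oplus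 S$ let $\Phi^C$ be its adjoint: $(C\otimes\tau_i)(\Phi^C\eta,\xi)=(C\otimes\tau_i)(\eta,\Phi\xi)$. For a connection $D=\nabla+\mathcal A$ on $S\oplus S$ put $D^C=\nabla-\mathcal A^C$ and $(\hat D_Z\gamma)(X)\xi=D_Z(\gamma(X)\xi)-\gamma(\nabla_ZX)\xi-\gamma(X)D^C_Z\xi$. $D$ is called admissible if $(\hat D_X\gamma)(Y)=-(\hat D_Y\gamma)(X)$ for all vector fields $X,Y$. *)

(* Defs.v *)
From HB Require Import structures.
From mathcomp Require Import all_boot all_order all_fingroup all_algebra.
From mathcomp Require Import complex.
From mathcomp Require Import boolp classical_sets functions cardinality reals.
From mathcomp Require Import topology normedtype derive.

Set Implicit Arguments.
Unset Strict Implicit.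
Unset Printing Implicit Defensive.

Import Order.TTheory GRing.Theory Num.Theory.
Import numFieldTopology.Exports numFieldNormedType.Exports.
Local Open Scope classical_set_scope.
Local Open Scope complex_scope.
Local Open Scope ring_scope.

(** * Smooth manifolds *)

Section Euclidean.
Variables (R : realType) (n : nat).
Implicit Types (V : set 'rV[R]_n) (f : 'rV[R]_n -> R).

(* [V] is meant to be open. *)
Fixpoint class_C (k : nat) V f : Prop :=
  (forall x, V x -> {for x, continuous f}) /\
  if k is k'.+1 then
    forall a : 'I_n,
      (forall x, V x -> derivable f x (delta_mx 0 a)) /\
      class_C k' V (fun x => 'D_(delta_mx 0 a) f x)
  else True.

Definition class_Coo V f := forall k, class_C k V f.

End Euclidean.

Record chart (R : realType) (n : nat) (M : topologicalType) := Chart {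
  cdom : set M;
  cmap : M -> 'rV[R]_n;
  cinv : 'rV[R]_n -> M }.

Definition is_chart (R : realType) (n : nat) (M : topologicalType)
    (c : chart R n M) : Prop :=
  [/\ open (cdom c), open (cmap c @` cdom c),
      forall x, cdom c x -> cinv c (cmap c x) = x,
      forall x, cdom c x -> {for x, continuous (cmap c)} &
      forall y, (cmap c @` cdom c) y -> {for y, continuous (cinv c)}].

Record manifold (R : realType) (n : nat) := Manifold {
  carrier :> topologicalType;
  atlas : set (chart R n carrier);
  manifold_hausdorff : hausdorff_space carrier;
  manifold_second_countable : @second_countable carrier;
  atlas_chart : forall c, atlas c -> is_chart c;
  atlas_cover : forall x : carrier, exists2 c, atlas c & cdom c x;
  atlas_compat : forall c c', atlas c -> atlas c' -> forall a : 'I_n,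
    class_Coo (cmap c @` (cdom c `&` cdom c'))
      (fun y => cmap c' (cinv c y) 0 a) }.

(* Fields on an open set are total functions on the manifold whose values
   outside that set are irrelevant. *)
Section Tensors.
Variables (R : realType) (n : nat) (M : manifold R n).

Definition smooth_on (U : set M) (f : M -> R) : Prop :=
  forall c, atlas c ->
    class_Coo (cmap c @` (cdom c `&` U)) (fun y => f (cinv c y)).

Definition smooth_at (x : M) (f : M -> R) : Prop :=
  exists U : set M, [/\ open U, U x & smooth_on U f].

Definition csmooth_on (U : set M) (f : M -> R[i]) : Prop :=
  smooth_on U (fun x => complex.Re (f x)) /\
  smooth_on U (fun x => complex.Im (f x)).

Definition functional := (M -> R) -> R.

(* Derivations at [x] of germs of smooth functions; the value on a function
   that is not smooth near [x] is normalised to 0, so that equality of tangent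
   vectors is equality of functionals. *)
Definition tangent (x : M) (v : functional) : Prop :=
  [/\ forall f, ~ smooth_at x f -> v f = 0,
      forall f h, smooth_at x f -> (\forall y \near x, f y = h y) -> v f = v h,
      forall a f h, smooth_at x f -> smooth_at x h ->
        v (fun y => a * f y + h y) = a * v f + v h &
      forall f h, smooth_at x f -> smooth_at x h ->
        v (fun y => f y * h y) = v f * h x + f x * v h].

Definition vector_field (U : set M) (X : M -> functional) : Prop :=
  (forall x, U x -> tangent x (X x)) /\
  (forall (V : set M) f, open V -> V `<=` U -> smooth_on V f ->
     smooth_on V (fun x => X x f)).

Definition pseudo_metric (g : M -> functional -> functional -> R) : Prop :=
  [/\ forall x a u v w, tangent x u -> tangent x v -> tangent x w ->
        g x (a *: u + v) w = a * g x u w + g x v w,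
      forall x v w, tangent x v -> tangent x w -> g x v w = g x w v,
      forall x v, tangent x v -> (forall w, tangent x w -> g x v w = 0) ->
        v = 0 &
      forall U X Y, open U -> vector_field U X -> vector_field U Y ->
        smooth_on U (fun x => g x (X x) (Y x))].

Record levi_civita (g : M -> functional -> functional -> R)
    (nab : (M -> functional) -> (M -> functional) -> M -> functional) : Prop :=
  LeviCivita {
  lc_field : forall U X Y, open U -> vector_field U X -> vector_field U Y ->
    vector_field U (nab X Y);
  lc_local : forall U X X' Y Y', open U ->
    vector_field U X -> vector_field U X' ->
    vector_field U Y -> vector_field U Y' ->
    (forall x, U x -> X x = X' x) -> (forall x, U x -> Y x = Y' x) ->
    forall x, U x -> nab X Y x = nab X' Y' x;
  lc_linear : forall U f X X' Y, open U -> smooth_on U f ->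
    vector_field U X -> vector_field U X' -> vector_field U Y ->
    forall x, U x ->
      nab (fun y => f y *: X y + X' y) Y x = f x *: nab X Y x + nab X' Y x;
  lc_leibniz : forall U f X Y Y', open U -> smooth_on U f ->
    vector_field U X -> vector_field U Y -> vector_field U Y' ->
    forall x, U x ->
      nab X (fun y => f y *: Y y + Y' y) x =
        X x f *: Y x + f x *: nab X Y x + nab X Y' x;
  lc_torsion : forall U X Y, open U -> vector_field U X -> vector_field U Y ->
    forall x f, U x -> smooth_at x f ->
      nab X Y x f - nab Y X x f =
        X x (fun y => Y y f) - Y x (fun y => X y f);
  lc_metric : forall U X Y Z, open U ->
    vector_field U X -> vector_field U Y -> vector_field U Z ->
    forall x, U x ->
      X x (fun y => g y (Y y) (Z y)) =
        g x (nab X Y x) (Z x) + g x (Y x) (nab X Z x) }.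

Definition diff_form (l : nat) (F : M -> ('I_l -> functional) -> R) : Prop :=
  [/\ forall x (v : 'I_l -> functional) r a u w,
        (forall s, tangent x (v s)) -> tangent x u -> tangent x w ->
        F x (fun s => if s == r then a *: u + w else v s) =
          a * F x (fun s => if s == r then u else v s) +
          F x (fun s => if s == r then w else v s),
      forall x (v : 'I_l -> functional) r s,
        (forall k, tangent x (v k)) -> r != s -> v r = v s -> F x v = 0 &
      forall U (X : 'I_l -> M -> functional), open U ->
        (forall s, vector_field U (X s)) ->
        smooth_on U (fun x => F x (fun s => X s x))].

Definition form_nonzero (l : nat) (F : M -> ('I_l -> functional) -> R) : Prop :=
  exists x v, (forall s, tangent x (v s)) /\ F x v != 0.

End Tensors.

(** * Spinor module *)

(* The complex spinor module of a quadratic space of dimension [n] has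
   dimension 2^(n/2) rounded down; a Clifford module of that dimension is
   automatically irreducible. *)
Definition spin_dim (n : nat) : nat := (2 ^ n./2)%N.

Section SpinorModule.
Variables (R : realType) (n t : nat).

(* Standard metric with [t] negative directions. *)
Definition eta (a : 'I_n) : R := if (a < t)%N then -1 else 1.

Definition eta_form (v w : 'rV[R]_n) : R := \sum_a eta a * v 0 a * w 0 a.

Variable gam : 'I_n -> 'M[R[i]]_(spin_dim n).

Definition clifford_rep : Prop :=
  forall a b, gam a *m gam b + gam b *m gam a =
    (- 2 * (if a == b then eta a else 0))%:C%:M.

Definition gamma_vec (v : 'rV[R]_n) : 'M[R[i]]_(spin_dim n) :=
  \sum_a (v 0 a)%:C *: gam a.

(* gamma_{mu_1 ... mu_k} *)
Definition gamma_skew (k : nat) (mu : 'I_k -> 'I_n) : 'M[R[i]]_(spin_dim n) :=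
  (k`!%:R)^-1 *: \sum_(s : 'S_k)
    (-1) ^+ s *: \big[mulmx/1%:M]_(r < k) gam (mu (s r)).

(* Image of Spin^+ in the spinor representation: products of an even number of
   unit vectors, an even number of which are negative.  The representation is
   faithful on the even part of the real Clifford algebra. *)
Definition spin_group (A : 'M[R[i]]_(spin_dim n)) : Prop :=
  exists vs : seq 'rV[R]_n,
    [/\ forall v, v \in vs -> `|eta_form v v| = 1,
        ~~ odd (size vs),
        \prod_(v <- vs) eta_form v v = 1 &
        A = \big[mulmx/1%:M]_(v <- vs) gamma_vec v].

Definition charge (C : 'M[R[i]]_(spin_dim n))
    (phi psi : 'cV[R[i]]_(spin_dim n)) : R[i] := (phi^T *m C *m psi) 0 0.

Definition charge_conjugation (C : 'M[R[i]]_(spin_dim n)) : Prop :=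
  (forall phi, (forall psi, charge C phi psi = 0) -> phi = 0) /\
  (forall A phi psi, spin_group A ->
     charge C (A *m phi) (A *m psi) = charge C phi psi).

Definition charge_signs (C : 'M[R[i]]_(spin_dim n)) (Delta : nat -> int) :
    Prop :=
  forall k, (Delta k = 1 \/ Delta k = -1) /\
    forall (mu : 'I_k -> 'I_n) phi psi,
      charge C phi (gamma_skew mu *m psi) =
        (Delta k)%:~R * charge C psi (gamma_skew mu *m phi).

End SpinorModule.

Section Pauli.
Variable R : realType.

Definition mx2 (a b c d : R[i]) : 'M[R[i]]_2 :=
  \matrix_(r, s) if r == 0 then (if s == 0 then a else b)
                 else (if s == 0 then c else d).

Definition tau (i : 'I_4) : 'M[R[i]]_2 :=
  match val i with
  | 0 => mx2 1 0 0 1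
  | 1 => mx2 0 1 1 0
  | 2 => mx2 0 1 (-1) 0
  | _ => mx2 1 0 0 (-1)
  end.

Definition commutation_signs (eps2 : 'I_4 -> 'I_4 -> int) : Prop :=
  forall i j, tau i *m tau j = (eps2 i j)%:~R *: (tau j *m tau i).

Definition transposition_signs (eps : 'I_4 -> int) : Prop :=
  forall j, (tau j)^T = (eps j)%:~R *: tau j.

End Pauli.

(** * Spin structures and spinor fields *)

(* A Spin^+-structure in local trivialisations: oriented and time-oriented
   orthonormal frames over an open cover, and a smooth lift to Spin^+ of their
   transition functions that satisfies the cocycle condition. *)
Record spin_structure (R : realType) (n t : nat) (M : manifold R n)
    (g : M -> functional M -> functional M -> R)
    (gam : 'I_n -> 'M[R[i]]_(spin_dim n)) := SpinStructure {
  gauge : Type;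
  gdom : gauge -> set M;
  frame : gauge -> 'I_n -> M -> functional M;
  trans : gauge -> gauge -> M -> 'M[R[i]]_(spin_dim n);
  gdom_open : forall i, open (gdom i);
  gdom_cover : forall x, exists i, gdom i x;
  frame_field : forall i a, vector_field (gdom i) (frame i a);
  frame_orthonormal : forall i a b x, gdom i x ->
    g x (frame i a x) (frame i b x) = if a == b then eta R t a else 0;
  frame_span : forall i x v, gdom i x -> tangent x v ->
    exists c : 'I_n -> R, v = \sum_a c a *: frame i a x;
  trans_smooth : forall i j r s,
    csmooth_on (gdom i `&` gdom j) (fun x => trans i j x r s);
  trans_spin : forall i j x, gdom i x -> gdom j x ->
    spin_group t gam (trans i j x);
  trans_cocycle : forall i j k x, gdom i x -> gdom j x -> gdom k x ->
    trans i j x *m trans j k x = trans i k x;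
  trans_lift : forall i j x (v w : 'rV[R]_n), gdom i x -> gdom j x ->
    \sum_a v 0 a *: frame i a x = \sum_a w 0 a *: frame j a x ->
    gamma_vec gam v *m trans i j x = trans i j x *m gamma_vec gam w }.

Section SpinorFields.
Variables (R : realType) (n t : nat) (M : manifold R n).
Variables (g : M -> functional M -> functional M -> R)
  (nab : (M -> functional M) -> (M -> functional M) -> M -> functional M)
  (gam : 'I_n -> 'M[R[i]]_(spin_dim n)) (S : spin_structure t g gam).

(* An element of S + S = S (x) C^2 is a matrix whose two columns are its
   components. *)
Local Notation fiber := 'M[R[i]]_(spin_dim n, 2).

Definition spinor_field (U : set M) (Xi : gauge S -> M -> fiber) : Prop :=
  (forall i r s, csmooth_on (U `&` gdom i) (fun x => Xi i x r s)) /\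
  (forall i j x, U x -> gdom i x -> gdom j x ->
     Xi i x = trans i j x *m Xi j x).

(* A (x) T acting on S (x) C^2. *)
Definition tensor_act (A : 'M[R[i]]_(spin_dim n)) (T : 'M[R[i]]_2)
    (xi : fiber) : fiber := A *m xi *m T^T.

(* gamma(v) in the trivialisation [i]; [eta a * g(v, e_a)] is the a-th
   component of v. *)
Definition clifford (i : gauge S) (x : M) (v : functional M) :
    'M[R[i]]_(spin_dim n) :=
  \sum_a (eta R t a * g x v (frame i a x))%:C *: gam a.

Definition deriv_fiber (v : functional M) (xi : M -> fiber) : fiber :=
  \matrix_(r, s) (v (fun y => complex.Re (xi y r s)) +i*
                  v (fun y => complex.Im (xi y r s))).

(* 1/4 omega_{ab}(X) gamma^a gamma^b with omega_{ab}(X) = g(nabla_X e_a, e_b);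
   the sign is the one for gamma(X)^2 = - g(X, X). *)
Definition spin_form (X : M -> functional M) (i : gauge S) (x : M) :
    'M[R[i]]_(spin_dim n) :=
  4%:R^-1 *: \sum_a \sum_b
    (eta R t a * eta R t b * g x (nab X (frame i a) x) (frame i b x))%:C
      *: (gam a *m gam b).

Definition nabla_spin (X : M -> functional M) (Xi : gauge S -> M -> fiber)
    (i : gauge S) (x : M) : fiber :=
  deriv_fiber (X x) (Xi i) + spin_form X i x *m Xi i x.

(* Local expressions of one-forms with values in End(S + S). *)
Definition potential := gauge S -> M -> functional M -> fiber -> fiber.

Definition connection (A : potential) (X : M -> functional M)
    (Xi : gauge S -> M -> fiber) (i : gauge S) (x : M) : fiber :=
  nabla_spin X Xi i x + A i x (X x) (Xi i x).

Definition charge2 (C : 'M[R[i]]_(spin_dim n)) (T : 'M[R[i]]_2)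
    (zeta xi : fiber) : R[i] :=
  \sum_a \sum_b T a b * charge C (col a zeta) (col b xi).

Definition is_adjoint (C : 'M[R[i]]_(spin_dim n)) (T : 'M[R[i]]_2)
    (Phi PhiC : fiber -> fiber) : Prop :=
  forall zeta xi, charge2 C T (PhiC zeta) xi = charge2 C T zeta (Phi xi).

(* (hat D_Z gamma)(X) xi for D = nabla + A and D^C = nabla - AC. *)
Definition Dhat_gamma (A AC : potential) (Z X : M -> functional M)
    (Xi : gauge S -> M -> fiber) (i : gauge S) (x : M) : fiber :=
  connection A Z (fun j y => clifford j y (X y) *m Xi j y) i x
  - clifford i x (nab Z X x) *m Xi i x
  - clifford i x (X x) *m
      connection (fun j y v xi => - AC j y v xi) Z Xi i x.

(* The adjoint AC is unique as the form C (x) T is non-degenerate.  Vector and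
   spinor fields range over all local ones. *)
Definition admissible (C : 'M[R[i]]_(spin_dim n)) (T : 'M[R[i]]_2)
    (A : potential) : Prop :=
  exists AC : potential,
    (forall i x v, gdom i x -> tangent x v ->
       is_adjoint C T (A i x v) (AC i x v)) /\
    (forall U X Y Xi, open U -> vector_field U X -> vector_field U Y ->
       spinor_field U Xi -> forall i x, U x -> gdom i x ->
       Dhat_gamma A AC X Y Xi i x = - Dhat_gamma A AC Y X Xi i x).

(* 1/l! F_{k_1 ... k_l} gamma^{k_1 ... k_l} *)
Definition form_clifford (l : nat) (F : M -> ('I_l -> functional M) -> R)
    (i : gauge S) (x : M) : 'M[R[i]]_(spin_dim n) :=
  (l`!%:R)^-1 *: \sum_(k : {ffun 'I_l -> 'I_n})
    (F x (fun r => frame i (k r) x) * \prod_r eta R t (k r))%:C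
      *: gamma_skew gam k.

(* The one-form with components 1/l! F_{k_1 ... k_l} gamma^{k_1 ... k_l} gamma_mu
   (x) T, evaluated on v = v^mu e_mu. *)
Definition form_potential (l : nat) (F : M -> ('I_l -> functional M) -> R)
    (T : 'M[R[i]]_2) : potential :=
  fun i x v => tensor_act (form_clifford F i x *m clifford i x v) T.

End SpinorFields.

Definition js_first (i : 'I_4) : seq nat :=
  nth [::] [:: [:: 2]; [:: 3]; [:: 1; 2; 3]; [:: 1]]%N i.

Definition js_second (i : 'I_4) : seq nat :=
  nth [::] [:: [:: 0; 1; 3]; [:: 0; 1; 2]; [:: 0]; [:: 0; 2; 3]]%N i.

(* Main.v *)
Require Import Defs.
From mathcomp Require Import all_boot all_order all_fingroup all_algebra.
From mathcomp Require Import complex.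
From mathcomp Require Import boolp classical_sets reals topology normedtype.
From mathcomp Require Import functions derive.
From mathcomp Require Import zify ring.

(* The Levi-Civita part of [D] drops out of [hat D gamma] because Clifford
   multiplication is parallel, leaving
   [A_Z gamma(X) + gamma(X) A_Z^C].  For [A_X = F gamma(X) (x) tau_j] the
   transposition signs give [A_X^C = s gamma(X) F (x) tau_j] with
   [s = Delta_l Delta_1 eps_j eps_ij], so by the Clifford relation the
   symmetrised expression is [-2 (1 + s) g(X, Y) F (x) tau_j].  A nonzero form
   acts nontrivially because products of [l] distinct gamma matrices are
   independent for fixed [l]: they are orthogonal for the trace form, even in
   odd dimension, since two of them always differ by a product of an even
   number of gamma matrices. *)

Set Implicit Arguments.
Unset Strict Implicit.
Unset Printing Implicit Defensive.

Import Order.TTheory GRing.Theory Num.Theory.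
Local Open Scope ring_scope.

(** Necessity is a test at one point. For [X = Y] a frame vector the scalar [-2 g(X, X)] is 2 or -2,
    so no null direction interferes in any signature; the test spinor has to be a genuine local
    field with arbitrary value at the point, which is obtained by fixing it in one gauge and
    transporting it to the others. The adjoint that [admissible] only asserts to exist is pinned
    down by non-degeneracy. The signs are given only through their defining relations and get their
    values by comparison on invertible matrices. For [Delta l] this takes [l] distinct gamma
    matrices, whence [l <= n] in the classification. The criterion then splits into a factor
    depending on [l] mod 4 and [Delta 0 * Delta 1], and a factor depending on [(i, j)]. The analytic
    obstacle is that a tangent vector obeys linearity and the Leibniz rule on smooth germs only, so
    every function that gets differentiated must first be shown smooth. *)

Section AnticommutingProducts.
Variables (K : fieldType) (N : nat).
Implicit Types (l : nat).

Lemma prod_pull_front l (f : 'I_l.+1 -> 'M[K]_N) (j : 'I_l.+1) :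
  (forall r s, r != s -> f r *m f s = - (f s *m f r)) ->
  \big[mulmx/1%:M]_r f r =
    (-1) ^+ j *: (f j *m \big[mulmx/1%:M]_(r < l) f (lift j r)).
Proof.
elim: l f j => [|l IHl] f j anti; rewrite big_ord_recl.
  by rewrite (ord1 j) scale1r !big_ord0.
case: (unliftP ord0 j) => [j'|] ->; last by rewrite scale1r.
rewrite (IHl (fun r => f (lift ord0 r)) j'); last first.
  by move=> r s rs; apply: anti; rewrite (inj_eq lift_inj).
rewrite -scalemxAr mulmxA anti //.
rewrite [in RHS]big_ord_recl mulmxA.
have -> : lift (lift ord0 j') ord0 = ord0 :> 'I_l.+2 by apply: val_inj.
have e r : lift (lift ord0 j') (lift ord0 r) = lift ord0 (lift j' r) :> 'I_l.+2.
  by apply: val_inj; rewrite /= /bump /=; lia.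
under [in RHS]eq_bigr do rewrite e.
by rewrite mulNmx exprS mulN1r scalerN scaleNr.
Qed.

(** Induction on the number of factors: the leading factor is [f (s ord0)], and bringing it to the
    front of the ordered product costs [(-1) ^+ s ord0], which is the factor relating the sign of
    [s] to that of the permutation of the remaining indices. *)
Lemma prod_perm_sign l (f : 'I_l -> 'M[K]_N) (s : 'S_l) :
  (forall r s, r != s -> f r *m f s = - (f s *m f r)) ->
  \big[mulmx/1%:M]_r f (s r) = (-1) ^+ s *: \big[mulmx/1%:M]_r f r.
Proof.
elim: l f s => [|l IHl] f s anti.
  by rewrite !big_ord0 (_ : s = 1%g) ?odd_perm1 ?scale1r //; apply/permP; case.
have [s' ->] : exists s', s = lift_perm ord0 (s ord0) s'.
  (* [h] is [s] on the nonzero indices, renumbered so as to skip [s ord0]. The default is never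
     taken, because [s] is injective. *)
  pose h r := odflt r (unlift (s ord0) (s (lift ord0 r))).
  have hE r : lift (s ord0) (h r) = s (lift ord0 r).
    rewrite /h; case: unliftP => [k -> //|/perm_inj/eqP].
    by rewrite eq_sym (negPf (neq_lift _ _)).
  have hI : injective h.
    move=> r r' /(congr1 (lift (s ord0))); rewrite !hE => /perm_inj.
    exact: lift_inj.
  exists (perm hI); apply/permP => r.
  case: (unliftP ord0 r) => [r' ->|->]; last by rewrite lift_perm_id.
  by rewrite lift_perm_lift permE hE.
rewrite big_ord_recl lift_perm_id.
under eq_bigr do rewrite lift_perm_lift.
rewrite (IHl (fun r => f (lift (s ord0) r))); last first.
  by move=> r r' rr; apply: anti; rewrite (inj_eq lift_inj).
rewrite (prod_pull_front (s ord0) anti) odd_lift_perm /= signr_addb.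
rewrite -scalemxAr scalerA; congr (_ *: _).
by rewrite signr_odd mulrC mulrA -expr2 sqrr_sign mul1r.
Qed.

End AnticommutingProducts.

(** * Products of gamma matrices and their linear independence in a fixed degree *)

Section CliffordProducts.
Variables (R : realType) (n t : nat).
Variable gam : 'I_n -> 'M[complex R]_(spin_dim n).
Hypothesis gam_cl : clifford_rep t gam.
Local Notation K := (complex R).
Local Notation N := (spin_dim n).
Local Open Scope complex_scope.
Local Open Scope ring_scope.

Lemma eta_sqr (a : 'I_n) : eta R t a * eta R t a = 1.
Proof. by rewrite /eta; case: ifP; rewrite ?mulrNN mulr1. Qed.

Lemma gam_sqr a : gam a *m gam a = (- (eta R t a)%:C)%:M.
Proof.
have := gam_cl a a; rewrite eqxx => h.
have two : (2 : K) != 0 by rewrite pnatr_eq0.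
apply: (scalerI two); rewrite scaler_nat mulr2n h scale_scalar_mx; congr (_%:M).
by rewrite rmorphM rmorphN rmorph_nat mulNr mulrN.
Qed.

Lemma gam_anticomm a b : a != b -> gam a *m gam b = - (gam b *m gam a).
Proof.
move=> ab; have := gam_cl a b; rewrite (negPf ab) mulr0 !raddf0.
by move=> /eqP; rewrite addr_eq0 => /eqP.
Qed.

Lemma gam_unit a : gam a \in unitmx.
Proof.
have e2 : (- (eta R t a)%:C) * (- (eta R t a)%:C) = 1 :> K.
  by rewrite mulrNN -rmorphM eta_sqr.
apply: (proj1 (@mulmx1_unit _ _ _ (- (eta R t a)%:C *: gam a) _)).
by rewrite -scalemxAr gam_sqr scale_scalar_mx e2.
Qed.

(** Unlike [gamma_skew], this is invertible even when indices repeat; for distinct indices the two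
    coincide. *)
Definition gamma_prod l (k : 'I_l -> 'I_n) : 'M[K]_N :=
  \big[mulmx/1%:M]_r gam (k r).

Lemma gamma_prod_unit l (k : 'I_l -> 'I_n) : gamma_prod k \in unitmx.
Proof.
rewrite /gamma_prod; elim/big_ind: _ => [|A B Au Bu|r _].
- exact: unitmx1.
- by rewrite unitmx_mul Au.
- exact: gam_unit.
Qed.

Lemma gamma_skew_perm l (k : 'I_l -> 'I_n) (s : 'S_l) :
  gamma_skew gam (fun r => k (s r)) = (-1) ^+ s *: gamma_skew gam k.
Proof.
rewrite /gamma_skew scalerA mulrC -scalerA; congr (_ *: _).
rewrite scaler_sumr [RHS](reindex_inj (mulIg s)) /=; apply: eq_bigr => u _.
rewrite odd_permM signr_addb scalerA mulrCA -expr2 sqrr_sign mulr1.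
by congr (_ *: _); apply: eq_bigr => r _; rewrite permM.
Qed.

Lemma gamma_skew_inj l (k : 'I_l -> 'I_n) :
  injective k -> gamma_skew gam k = gamma_prod k.
Proof.
move=> kI; rewrite /gamma_skew.
under eq_bigr => s _.
  rewrite (prod_perm_sign (f := fun r => gam (k r))) => [|r r' rr]; last first.
    by rewrite gam_anticomm // (inj_eq kI).
  rewrite scalerA -expr2 sqrr_sign scale1r; over.
rewrite sumr_const card_Sn -[X in _ *: X]scaler_nat scalerA mulVf ?scale1r //.
by rewrite pnatr_eq0 -lt0n fact_gt0.
Qed.

(** The exponent counts the factors that [gam b] anticommutes with, namely all except copies of
    itself. *)
Lemma gam_gamma_prod b l (k : 'I_l -> 'I_n) :
  gam b *m gamma_prod k = (-1) ^+ (\sum_r (b != k r))%N *: (gamma_prod k *m gam b).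
Proof.
rewrite /gamma_prod; elim: l k => [|l IHl] k.
  by rewrite !big_ord0 scale1r mulmx1 mul1mx.
rewrite !big_ord_recl mulmxA.
have -> : gam b *m gam (k ord0) = (-1) ^+ (b != k ord0) *: (gam (k ord0) *m gam b).
  have [<-|bk] := eqVneq b (k ord0); first by rewrite scale1r.
  by rewrite gam_anticomm //= scaleN1r.
by rewrite -scalemxAl -mulmxA IHl -scalemxAr scalerA -exprD mulmxA.
Qed.

Lemma count_neq_notin b l (k : 'I_l -> 'I_n) :
  b \notin codom k -> (\sum_r (b != k r))%N = l.
Proof.
move=> bk; rewrite -[RHS]card_ord -sum1_card; apply: eq_bigr => r _.
by case: eqVneq => // e; case/negP: bk; rewrite e codom_f.
Qed.

Lemma count_neq_inj l (k : 'I_l -> 'I_n) (r0 : 'I_l) :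
  injective k -> ((\sum_r (k r0 != k r))%N).+1 = l.
Proof.
move=> kI; rewrite -[RHS]card_ord -sum1_card (bigD1 r0) //= eqxx add0n.
rewrite [in RHS](bigD1 r0) //= add1n; congr _.+1; apply: eq_bigr => r rr.
by rewrite (inj_eq kI) eq_sym rr.
Qed.

(** With [b = k r], [gam b] picks up [l] signs passing the inverse of [gamma_prod k0] and [l - 1]
    signs passing [gamma_prod k]. The total is odd because both products have the same length, so
    [gam b] anticommutes with the whole matrix, and conjugating by [gam b] negates a trace that it
    must preserve. *)
Lemma trace_gamma_prod l (k k0 : 'I_l -> 'I_n) (r : 'I_l) :
  injective k -> k r \notin codom k0 ->
  \tr (invmx (gamma_prod k0) *m gamma_prod k) = 0.
Proof.
move=> kI kr; set b := k r; set X := _ *m _.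
have u0 := gamma_prod_unit k0.
have invE : gam b *m invmx (gamma_prod k0) =
    (-1) ^+ l *: (invmx (gamma_prod k0) *m gam b).
  apply: (can_inj (mulKmx u0)); rewrite -scalemxAr mulKVmx //.
  apply: (can_inj (mulmxK u0)); rewrite -scalemxAl mulmxA mulmxKV //.
  rewrite gam_gamma_prod count_neq_notin // scalerA.
  by rewrite -expr2 sqrr_sign scale1r.
have gX : gam b *m X = - (X *m gam b).
  rewrite /X mulmxA invE -scalemxAl -(mulmxA _ (gam b)) gam_gamma_prod -scalemxAr scalerA.
  rewrite -exprD; have := count_neq_inj r kI; rewrite -/b.
  set m := (\sum_r0 _)%N => ml.
  have -> : (l + m = (m * 2).+1)%N by lia.
  rewrite exprS exprM.
  by rewrite sqrr_sign mulr1 scaleN1r mulmxA.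
have : \tr X = - \tr X.
  rewrite -[in LHS](mulKmx (gam_unit b) X) gX mulmxN raddfN /=.
  by rewrite mxtrace_mulC mulmxK ?gam_unit.
move/eqP; rewrite -addr_eq0 -mulr2n mulrn_eq0 /=; exact: eqP.
Qed.

(** The sum runs over all index tuples, and reorderings of one tuple give proportional matrices.
    Independence therefore holds only among skew coefficients, which is what the two hypotheses on
    [c] say. *)
Lemma gamma_skew_free l (c : {ffun 'I_l -> 'I_n} -> K) :
  (forall k : {ffun 'I_l -> 'I_n}, ~~ injectiveb k -> c k = 0) ->
  (forall (k : {ffun 'I_l -> 'I_n}) (s : 'S_l),
     c [ffun r => k (s r)] = (-1) ^+ s * c k) ->
  \sum_k c k *: gamma_skew gam k = 0 -> forall k, c k = 0.
Proof.
move=> c0 cs sum0 k0; have [/injectiveP kI0|/c0//] := boolP (injectiveb k0).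
(* [P] selects the reorderings of [k0]; these are the only terms with nonzero trace against
   [gamma_prod k0]. *)
pose P (k : {ffun 'I_l -> 'I_n}) :=
  injectiveb k && [forall r, k r \in codom k0].
have term k : c k * \tr (invmx (gamma_prod k0) *m gamma_skew gam k) =
    if P k then c k0 * N%:R else 0.
  rewrite /P; have [/injectiveP kI|/c0 -> /=] := boolP (injectiveb k); last first.
    by rewrite mul0r.
  have [/forallP kk0|] := boolP [forall r, k r \in codom k0]; last first.
    rewrite negb_forall => /existsP[r kr].
    by rewrite gamma_skew_inj // (trace_gamma_prod kI kr) mulr0.
  pose h r := iinv (kk0 r).
  have hE r : k0 (h r) = k r by exact: f_iinv.
  have hI : injective h by move=> r r' e; apply: kI; rewrite -!hE e.
  have kE : k = [ffun r => k0 (perm hI r)].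
    by apply/ffunP => r; rewrite ffunE permE hE.
  (* The sign of the reordering enters through the coefficient and through the matrix and cancels,
     so all reorderings contribute equally. *)
  rewrite kE cs (_ : gamma_skew gam _ = (-1) ^+ perm hI *: gamma_skew gam k0).
    rewrite (gamma_skew_inj kI0) -scalemxAr mulVmx ?gamma_prod_unit //.
    rewrite linearZ /= mxtrace1 mulrACA.
    by rewrite -expr2 sqrr_sign mul1r.
  rewrite -gamma_skew_perm /gamma_skew; congr (_ *: _); apply: eq_bigr => s _.
  by congr (_ *: _); apply: eq_bigr => r _; rewrite ffunE.
have : \tr (invmx (gamma_prod k0) *m (\sum_k c k *: gamma_skew gam k)) = 0.
  by rewrite sum0 mulmx0 raddf0.
rewrite mulmx_sumr raddf_sum /=.
under eq_bigr do rewrite -scalemxAr linearZ /= term.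
(* The trace is now the number of reorderings times [c k0] times [N]; the number is positive since
   [k0] is among them. *)
rewrite -big_mkcond sumr_const /= => /eqP.
rewrite mulrn_eq0 mulf_eq0 pnatr_eq0 => /or3P[|/eqP//|].
- move/eqP/card0_eq/(_ k0); rewrite unfold_in /P => /negbT/negP[].
  apply/andP; split; first exact/injectiveP.
  by apply/forallP => r; exact: codom_f.
- by rewrite /spin_dim expn_eq0.
Qed.

End CliffordProducts.

Lemma intr_scale_unit_inj (F : numFieldType) N (U : 'M[F]_N) (a b : int) :
  (0 < N)%N -> U \in unitmx -> a%:~R *: U = b%:~R *: U -> a = b.
Proof.
case: N U => // N U _ Uu /eqP; rewrite -subr_eq0 -scalerBl scaler_eq0 => /orP[|/eqP U0].
  by rewrite subr_eq0 eqr_int => /eqP.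
by move: Uu; rewrite U0 unitmxE det0 ?unitr0.
Qed.

(** * Explicit signs of the modified Pauli matrices *)

Section Pauli.
Variable R : realType.
Local Open Scope complex_scope.
Local Open Scope ring_scope.
Local Notation K := R[i].
Local Notation tau := (tau R).

(** Closed form of the signs that [transposition_signs] specifies by a matrix equation. *)
Definition tau_sym (j : nat) : int := if j == 2 then -1 else 1.

Definition tau_comm (i j : nat) : int :=
  if [|| i == 0, j == 0 | i == j]%N then 1 else -1.

Lemma tau_tr j : (tau j)^T = (tau_sym j)%:~R *: tau j.
Proof.
apply/matrixP => -[[|[|//]] ?] [[|[|//]] ?]; case: j => -[|[|[|[|//]]]] ? /=;
  rewrite /tau /= !mxE /= /tau_sym /= ?mulrN1z ?mulr1z; ring.
Qed.

Lemma tau_mulC i j : tau i *m tau j = (tau_comm i j)%:~R *: (tau j *m tau i).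
Proof.
apply/matrixP => -[[|[|//]] ?] [[|[|//]] ?]; case: i => -[|[|[|[|//]]]] ?;
  case: j => -[|[|[|[|//]]]] ?; rewrite /tau /= !mxE !big_ord_recl !big_ord0;
  rewrite !mxE /= /tau_comm /= ?mulrN1z ?mulr1z; ring.
Qed.

Lemma tau_unit j : tau j \in unitmx.
Proof.
apply: (proj1 (@mulmx1_unit _ _ _ ((tau_sym j)%:~R *: tau j) _)).
apply/matrixP => -[[|[|//]] ?] [[|[|//]] ?]; case: j => -[|[|[|[|//]]]] ?;
  rewrite /tau /= !mxE !big_ord_recl !big_ord0;
  rewrite !mxE /= /tau_sym /= ?mulrN1z ?mulr1z; ring.
Qed.

Lemma transposition_signsE eps j : transposition_signs R eps -> eps j = tau_sym j.
Proof.
move=> /(_ j); rewrite tau_tr => e; symmetry.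
by apply: (intr_scale_unit_inj _ (tau_unit j) e).
Qed.

Lemma commutation_signsE eps2 i j :
  commutation_signs R eps2 -> eps2 i j = tau_comm i j.
Proof.
move=> /(_ i j); rewrite tau_mulC => e; symmetry.
by apply: (intr_scale_unit_inj _ _ e); rewrite // unitmx_mul !tau_unit.
Qed.

(** The two tables are the level sets of the part of the criterion that does not involve [l]. *)
Lemma js_firstE (i j : 'I_4) :
  ((j : nat) \in js_first i) = (tau_sym j * tau_comm i j == -1).
Proof. by case: i j => -[|[|[|[|//]]]] ? [[|[|[|[|//]]]] ?]. Qed.

Lemma js_secondE (i j : 'I_4) :
  ((j : nat) \in js_second i) = (tau_sym j * tau_comm i j == 1).
Proof. by case: i j => -[|[|[|[|//]]]] ? [[|[|[|[|//]]]] ?]. Qed.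

End Pauli.

(** * Adjoints of gamma matrices with respect to [C], and the values of [Delta] *)

Section ChargeSigns.
Variables (R : realType) (n t : nat).
Variable gam : 'I_n -> 'M[complex R]_(spin_dim n).
Hypothesis gam_cl : clifford_rep t gam.
Variable C : 'M[complex R]_(spin_dim n).
Hypothesis C_charge : charge_conjugation t gam C.
Variable Delta : nat -> int.
Hypothesis Delta_signs : charge_signs gam C Delta.
Local Open Scope complex_scope.
Local Open Scope ring_scope.
Local Notation K := R[i].
Local Notation N := (spin_dim n).

Lemma Delta_sqr k : Delta k * Delta k = 1.
Proof. by have [[] ->] := Delta_signs k. Qed.

Lemma charge_unit : C \in unitmx.
Proof.
rewrite -row_free_unit -kermx_eq0; apply/eqP/row_matrixP => r.
rewrite row0; apply: trmx_inj; rewrite trmx0; apply: C_charge.1 => psi.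
by rewrite /charge trmxK -row_mul mulmx_ker row0 mul0mx mxE.
Qed.

Lemma charge_inj (A B : 'M[K]_N) :
  (forall phi psi, charge A phi psi = charge B phi psi) -> A = B.
Proof.
move=> AB; apply/matrixP => r s.
have := AB (delta_mx r 0) (delta_mx s 0).
by rewrite /charge !trmx_delta -!rowE -!colE !mxE.
Qed.

Lemma charge_skew k (mu : 'I_k -> 'I_n) :
  C *m gamma_skew gam mu = (Delta k)%:~R *: (C *m gamma_skew gam mu)^T.
Proof.
apply: charge_inj => phi psi.
have [_ /(_ mu phi psi)] := Delta_signs k.
rewrite /charge; move: (gamma_skew gam mu) => G.
rewrite !mulmxA => ->; rewrite -scalemxAr -scalemxAl [RHS]mxE; congr (_ * _).
by rewrite -(trace_mx11 (_ *m phi)) -mxtrace_tr !trmx_mul trmxK !mulmxA trace_mx11.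
Qed.

Lemma charge_tr : C^T = (Delta 0)%:~R *: C.
Proof.
(* For the empty tuple [gamma_skew] is the identity, so degree 0 describes the symmetry of [C]
   itself. *)
have := charge_skew (fun r : 'I_0 =>
  match r with Ordinal _ h => False_rect _ (notF h) end).
rewrite (gamma_skew_inj gam_cl); last by case.
rewrite /gamma_prod big_ord0 mulmx1 => {2}->.
by rewrite scalerA -rmorphM Delta_sqr scale1r.
Qed.

Lemma gamma_skew_tr k (mu : 'I_k -> 'I_n) :
  (gamma_skew gam mu)^T *m C =
    (Delta 0 * Delta k)%:~R *: (C *m gamma_skew gam mu).
Proof.
rewrite charge_skew trmx_mul charge_tr -scalemxAr !scalerA -!rmorphM.
by rewrite -!mulrA (mulrA (Delta k)) Delta_sqr mul1r Delta_sqr scale1r.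
Qed.

Lemma gam_tr a : (gam a)^T *m C = (Delta 0 * Delta 1)%:~R *: (C *m gam a).
Proof.
have := gamma_skew_tr (fun _ : 'I_1 => a).
rewrite (gamma_skew_inj gam_cl) => [|r s _]; last by rewrite !ord1.
by rewrite /gamma_prod big_ord_recl big_ord0 mulmx1.
Qed.

(** Each factor contributes [Delta 0 * Delta 1], and restoring the order that transposition reverses
    takes ['C(k, 2)] exchanges of anticommuting matrices. *)
Lemma gamma_prod_tr k (mu : 'I_k -> 'I_n) : injective mu ->
  (gamma_prod gam mu)^T *m C =
    ((-1) ^+ 'C(k, 2) * (Delta 0 * Delta 1) ^+ k)%:~R *: (C *m gamma_prod gam mu).
Proof.
rewrite /gamma_prod; elim: k mu => [|k IHk] mu muI.
  by rewrite !big_ord0 trmx1 mul1mx mulmx1 scale1r.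
rewrite !big_ord_recl trmx_mul -mulmxA gam_tr -scalemxAr (mulmxA _ C) IHk; last first.
  by move=> r s /muI/lift_inj.
rewrite -scalemxAl scalerA -mulmxA (_ : _ *m gam _ = (-1) ^+ k *:
  (gam (mu ord0) *m \big[mulmx/1%:M]_(i < k) gam (mu (lift ord0 i)))); last first.
  have := gam_gamma_prod gam_cl (mu ord0) (fun r => mu (lift ord0 r)).
  rewrite /gamma_prod => ->; rewrite count_neq_notin ?scalerA -?expr2 ?sqrr_sign ?scale1r //.
  by apply/codomP => -[r /muI/eqP]; rewrite (negPf (neq_lift _ _)).
rewrite -scalemxAr scalerA binS bin1 -[(-1) ^+ k](rmorph_sign intr) -!rmorphM.
by congr (_%:~R *: _); rewrite exprD exprS; ring.
Qed.

(** The transpose of a product of [l] distinct gamma matrices is evaluated in two ways. For [l > n]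
    there are no distinct indices, every [gamma_skew] of degree [l] vanishes, and [Delta l] could be
    either sign. *)
Lemma DeltaE l : (0 < n)%N -> (l <= n)%N ->
  Delta l * Delta 1 = (-1) ^+ 'C(l, 2) * (Delta 0 * Delta 1) ^+ l.+1.
Proof.
move=> n_gt0 ln.
have muI : injective (widen_ord ln) by move=> r s /(congr1 val)/= /val_inj.
have := gamma_skew_tr (widen_ord ln).
rewrite (gamma_skew_inj gam_cl muI) (gamma_prod_tr muI) => e.
have {}e : (-1) ^+ 'C(l, 2) * (Delta 0 * Delta 1) ^+ l = Delta 0 * Delta l.
  apply: (intr_scale_unit_inj _ _ e); first by rewrite expn_gt0.
  by rewrite unitmx_mul charge_unit (gamma_prod_unit gam_cl).
rewrite exprS mulrCA e.
by rewrite mulrACA Delta_sqr mul1r mulrC.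
Qed.

End ChargeSigns.

(** The sign has period 4, because ['C(m + 4, 2) - 'C(m, 2) = 4m + 6] is even. *)
Lemma sign_bin2 l : (-1) ^+ 'C(l, 2) = (if (l %% 4 < 2)%N then 1 else -1) :> int.
Proof.
rewrite {1}(divn_eq l 4); set r := (l %% 4)%N.
have : (r < 4)%N by rewrite ltn_mod.
elim: (l %/ 4)%N => [|q IHq] r4; first by case: r r4 => [|[|[|[|//]]]].
rewrite -IHq // mulSn -addnA !addSn add0n; set m := (_ + _)%N.
rewrite !binS !bin1 !bin0; set b := 'C(m, 2).
by rewrite -signr_odd -[in RHS]signr_odd; congr (_ ^+ _); lia.
Qed.

(** For odd [l] the power of [d] is 1 and the residue 1 or 3 decides. For even [l] the factor [d]
    remains, and [1 - d], [1 + d] are the even residues 0 and 2 in the order dictated by [d]. *)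
Lemma charge_sign_classes (d x : int) (l : nat) : d = 1 \/ d = -1 ->
  x = (-1) ^+ 'C(l, 2) * d ^+ l.+1 ->
  ((l%:Z = 1 %[mod 4])%Z \/ (l%:Z = 1 - d %[mod 4])%Z <-> x = 1) /\
  ((l%:Z = 3 %[mod 4])%Z \/ (l%:Z = 1 + d %[mod 4])%Z <-> x = -1).
Proof.
rewrite sign_bin2 => d1 ->.
have -> : d ^+ l.+1 = if odd l then 1 else d.
  case: d1 => ->; first by rewrite expr1n; case: ifP.
  by rewrite -signr_odd /=; case: (odd l).
case: d1 => ->; case: ifP; case: ifP => ? ?; split; split; lia.
Qed.

(** * Locality and algebraic stability of the classes [class_C] *)

Section SmoothFunctions.
Import numFieldTopology.Exports numFieldNormedType.Exports.
Local Open Scope classical_set_scope.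
Local Open Scope ring_scope.
Variables (R : realType) (n : nat).
Implicit Types (V : set 'rV[R]_n) (f h : 'rV[R]_n -> R).

Lemma near_open V f h x : open V -> V x -> (forall y, V y -> f y = h y) ->
  \forall y \near x, f y = h y.
Proof.
by move=> Vo Vx fh; apply: filterS (open_nbhs_nbhs (conj Vo Vx)) => y; exact: fh.
Qed.

Lemma class_C_eq k V f h : open V -> (forall x, V x -> f x = h x) ->
  class_C k V f -> class_C k V h.
Proof.
move=> Vo; have cont f1 f2 : (forall x, V x -> f1 x = f2 x) ->
    (forall x, V x -> {for x, continuous f1}) ->
    forall x, V x -> {for x, continuous f2}.
  move=> fh cf x Vx; rewrite /prop_for /continuous_at -(fh _ Vx).
  apply: cvg_trans (cf x Vx).
  exact: (@near_eq_cvg _ _ (nbhs x) _ _ _ (near_open Vo Vx fh)).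
elim: k f h => [|k IHk] f h fh [cf df]; split; [exact: cont cf|by []|exact: cont cf|].
move=> a; have [dfa cfa] := df a; split=> [x Vx|].
  by apply: near_eq_derivable (dfa x Vx); exact: near_open Vo Vx fh.
by apply: IHk cfa => x Vx; apply: near_eq_derive; exact: near_open Vo Vx fh.
Qed.

Lemma class_CW k V f : class_C k.+1 V f -> class_C k V f.
Proof.
elim: k f => [|k IHk] f [cf df]; split=> //.
move=> a; by have [dfa cfa] := df a; split=> //; exact: IHk.
Qed.

Lemma class_C_cst k V (c : R) : class_C k V (fun=> c).
Proof.
elim: k c => [|k IHk] c; split=> //; [by move=> *; exact: cst_continuous.. |].
move=> a; split=> [x _|]; first exact: derivable_cst.
have -> : (fun x : 'rV[R]_n => 'D_(delta_mx 0 a) (fun=> c) x) = (fun=> 0 : R).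
  by apply/funext => x; exact: derive_cst.
exact: IHk.
Qed.

Lemma class_CD k V f h : open V ->
  class_C k V f -> class_C k V h -> class_C k V (fun x => f x + h x).
Proof.
move=> Vo; elim: k f h => [|k IHk] f h [cf df] [ch dh].
  by split=> // x Vx; apply: continuousD; [exact: cf | exact: ch].
split=> [x Vx|a]; first by apply: continuousD; [exact: cf | exact: ch].
have [dfa cfa] := df a; have [dha cha] := dh a; split=> [x Vx|].
    by apply: derivableD; [exact: dfa | exact: dha].
  apply: class_C_eq (IHk _ _ cfa cha) => // x Vx.
  by rewrite -deriveD; [| exact: dfa | exact: dha].
Qed.

Lemma class_CM k V f h : open V ->
  class_C k V f -> class_C k V h -> class_C k V (fun x => f x * h x).
Proof.
move=> Vo; elim: k f h => [|k IHk] f h fC hC.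
  have [[cf _] [ch _]] := (fC, hC); split=> // x Vx.
  by apply: continuousM; [exact: cf | exact: ch].
have [[cf df] [ch dh]] := (fC, hC); split=> [x Vx|a].
  by apply: continuousM; [exact: cf | exact: ch].
have [dfa cfa] := df a; have [dha cha] := dh a; split=> [x Vx|].
  by apply: derivableM; [exact: dfa | exact: dha].
(* The product rule pairs a derivative of class [k] with an undifferentiated factor of class [k.+1],
   which is first weakened to class [k]. *)
have fha := IHk _ _ (class_CW fC) cha; have hfa := IHk _ _ (class_CW hC) cfa.
apply: class_C_eq (class_CD Vo fha hfa) => // x Vx.
by rewrite [RHS]deriveM; [| exact: dfa | exact: dha].
Qed.

End SmoothFunctions.

(** * Smooth functions and tangent vectors as derivations on the manifold *)

Section TangentVectors.
Import numFieldTopology.Exports numFieldNormedType.Exports.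
Local Open Scope classical_set_scope.
Local Open Scope ring_scope.
Variables (R : realType) (n : nat) (M : manifold R n).
Implicit Types (U : set M) (f h : M -> R) (x : M) (v w : functional M).

Lemma open_chart_image c U :
  atlas c -> open U -> open (cmap c @` (cdom c `&` U)).
Proof.
move=> ac Uo; have [domo imo cK _ cinvC] := atlas_chart ac.
have -> : cmap c @` (cdom c `&` U) = (cmap c @` cdom c) `&` (cinv c @^-1` U).
  apply/seteqP; split=> y /=.
    by case=> z [dz Uz] <-; split; [exists z | rewrite cK].
  by case=> -[z dz <-]; rewrite cK // => Uz; exists z.
rewrite openE => y [imy Uy]; apply: filterI; first exact: open_nbhs_nbhs.
by apply: (cinvC y imy); apply: open_nbhs_nbhs.
Qed.

Lemma smooth_on_cst U (a : R) : smooth_on U (fun=> a).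
Proof. by move=> c ac k; exact: class_C_cst. Qed.

Lemma smooth_onD U f h : open U ->
  smooth_on U f -> smooth_on U h -> smooth_on U (fun x => f x + h x).
Proof.
move=> Uo fs hs c ac k.
exact: class_CD (open_chart_image ac Uo) (fs c ac k) (hs c ac k).
Qed.

Lemma smooth_onM U f h : open U ->
  smooth_on U f -> smooth_on U h -> smooth_on U (fun x => f x * h x).
Proof.
move=> Uo fs hs c ac k.
exact: class_CM (open_chart_image ac Uo) (fs c ac k) (hs c ac k).
Qed.

Lemma smooth_on_sum U (I : Type) (r : seq I) (F : I -> M -> R) : open U ->
  (forall a, smooth_on U (F a)) -> smooth_on U (fun x => \sum_(a <- r) F a x).
Proof.
move=> Uo Fs; elim: r => [|a r IHr].
  rewrite (_ : (fun x => \sum_(a <- [::]) F a x) = fun=> 0); first exact: smooth_on_cst.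
  by apply/funext => x; rewrite big_nil.
rewrite (_ : (fun x => \sum_(b <- a :: r) F b x) = fun x => F a x + \sum_(a <- r) F a x).
  exact: smooth_onD.
by apply/funext => x; rewrite big_cons.
Qed.

Section AtPoint.
Variables (x : M) (v : functional M).
Hypothesis v_tangent : tangent x v.
Variable U : set M.
Hypothesis U_open : open U.
Hypothesis Ux : U x.

(** The Leibniz rule on [1 * 1] gives [v 1 = 2 v 1]; linearity extends this to other constants. *)
Lemma tangent_cst (a : R) : v (fun=> a) = 0.
Proof.
have [_ _ lin leib] := v_tangent.
have sm b : smooth_at x (fun=> b) by exists U; split=> //; exact: smooth_on_cst.
have v1 : v (fun=> 1) = 0.
  have := leib _ _ (sm 1) (sm 1).
  rewrite /= !mulr1 mul1r.
  by move/eqP; rewrite -subr_eq subrr eq_sym => /eqP.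
have v0 : v (fun=> 0) = 0.
  have := lin 1 _ _ (sm 0) (sm 0).
  rewrite /= mulr0 addr0 mul1r.
  by move/eqP; rewrite -subr_eq subrr eq_sym => /eqP.
have := lin a _ _ (sm 1) (sm 0).
by rewrite /= mulr1 addr0 v1 v0 mulr0 addr0.
Qed.

Lemma tangent_eq f h : smooth_on U f -> (forall y, U y -> f y = h y) -> v f = v h.
Proof.
move=> fs fh; have [_ loc _ _] := v_tangent; apply: loc; first by exists U.
by apply: filterS (open_nbhs_nbhs (conj U_open Ux)) => y; exact: fh.
Qed.

Lemma tangentD f h : smooth_on U f -> smooth_on U h ->
  v (fun y => f y + h y) = v f + v h.
Proof.
move=> fs hs; have [_ _ lin _] := v_tangent.
rewrite -[v f]mul1r -lin; [|by exists U|by exists U].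
by congr v; apply/funext => ?; rewrite mul1r.
Qed.

Lemma tangentM f h : smooth_on U f -> smooth_on U h ->
  v (fun y => f y * h y) = v f * h x + f x * v h.
Proof. by move=> fs hs; have [_ _ _ leib] := v_tangent; apply: leib; exists U. Qed.

Lemma tangentZ a f : smooth_on U f -> v (fun y => a * f y) = a * v f.
Proof.
move=> fs; rewrite (tangentM (smooth_on_cst _ a) fs) tangent_cst.
by rewrite mul0r add0r.
Qed.

Lemma tangent_sum (I : Type) (r : seq I) (F : I -> M -> R) :
  (forall a, smooth_on U (F a)) ->
  v (fun y => \sum_(a <- r) F a y) = \sum_(a <- r) v (F a).
Proof.
move=> Fs; elim: r => [|a r IHr].
  rewrite big_nil (_ : (fun y => \sum_(a <- [::]) F a y) = fun=> 0) ?tangent_cst //.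
  by apply/funext => ?; rewrite big_nil.
rewrite big_cons -IHr -tangentD //; last exact: smooth_on_sum.
by congr v; apply/funext => ?; rewrite big_cons.
Qed.

End AtPoint.

Lemma tangent0 x : tangent x 0.
Proof. by split=> // *; rewrite !(mulr0, mul0r) addr0. Qed.

Lemma tangent_linear x a u w : tangent x u -> tangent x w -> tangent x (a *: u + w).
Proof.
have E f : (a *: u + w) f = a * u f + w f by [].
move=> [u0 ul ulin uleib] [w0 wl wlin wleib]; split=> [f nf|f h fs fh|b f h fs hs|f h fs hs].
- by rewrite E u0 // w0 // mulr0 addr0.
- by rewrite !E (ul _ _ fs fh) (wl _ _ fs fh).
- by rewrite !E ulin // wlin //; ring.
- by rewrite !E uleib // wleib //; ring.
Qed.

Lemma tangent_span x (I : Type) (r : seq I) (c : I -> R) (e : I -> functional M) :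
  (forall a, tangent x (e a)) -> tangent x (\sum_(a <- r) c a *: e a).
Proof.
move=> et; elim: r => [|a r IHr]; first by rewrite big_nil; exact: tangent0.
by rewrite big_cons; exact: tangent_linear.
Qed.

(** Linearity of [L] is available on tangent vectors only, not on all functionals, so each partial
    sum must be known to be tangent. *)
Lemma tangent_linear_sum x (L : functional M -> R) (I : Type) (r : seq I)
    (c : I -> R) (e : I -> functional M) :
  (forall a u w, tangent x u -> tangent x w -> L (a *: u + w) = a * L u + L w) ->
  (forall a, tangent x (e a)) ->
  L (\sum_(a <- r) c a *: e a) = \sum_(a <- r) c a * L (e a).
Proof.
move=> Llin et; have L0 : L 0 = 0.
  have := Llin 1 _ _ (tangent0 x) (tangent0 x).
  by rewrite scaler0 addr0 mul1r => /eqP; rewrite -subr_eq subrr eq_sym => /eqP.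
elim: r => [|a r IHr]; first by rewrite !big_nil.
by rewrite !big_cons Llin ?IHr //; exact: tangent_span.
Qed.

Lemma vector_fieldS (U V : set M) (X : M -> functional M) :
  V `<=` U -> vector_field U X -> vector_field V X.
Proof.
move=> VU [Xt Xs]; split=> [x Vx|W f Wo WV]; first exact/Xt/VU.
by apply: Xs => // y /WV/VU.
Qed.

End TangentVectors.

(** * Skew-symmetry of forms and their values on frames *)

Section Forms.
Import numFieldTopology.Exports numFieldNormedType.Exports.
Variables (R : realType) (n : nat) (M : manifold R n) (l : nat).
Variable F : M -> ('I_l -> functional M) -> R.
Hypothesis F_form : diff_form F.
Variable x : M.

Lemma form_perm (v : 'I_l -> functional M) (s : 'S_l) :
  (forall r, tangent x (v r)) -> F x (fun r => v (s r)) = (-1) ^+ s * F x v.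
Proof.
have [Flin Falt _] := F_form.
have swap (w : 'I_l -> functional M) (p q : 'I_l) : p != q ->
    (forall r, tangent x (w r)) -> F x (fun r => w (tperm p q r)) = - F x w.
  (* Polarisation: [W] fills the slots [p] and [q], and expanding the vanishing value at [w p + w q]
     in both slots leaves the two exchanged terms. *)
  move=> pq wt; pose W u1 u2 r := if r == p then u1 else if r == q then u2 else w r.
  have Wt u1 u2 : tangent x u1 -> tangent x u2 -> forall r, tangent x (W u1 u2 r).
    by move=> u1t u2t r; rewrite /W; do 2 case: ifP => // _.
  have W1 u1 u1' u2 : tangent x u1 -> tangent x u1' -> tangent x u2 ->
      F x (W (u1 + u1') u2) = F x (W u1 u2) + F x (W u1' u2).
    move=> u1t u1't u2t.
    have := Flin x (W 0 u2) p 1 u1 u1' (Wt _ _ (tangent0 x) u2t) u1t u1't.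
    rewrite mul1r scale1r => E; rewrite /W; move: E.
    by congr (F x _ = F x _ + F x _); apply/funext => r; rewrite /W; case: eqP.
  have W2 u1 u2 u2' : tangent x u1 -> tangent x u2 -> tangent x u2' ->
      F x (W u1 (u2 + u2')) = F x (W u1 u2) + F x (W u1 u2').
    move=> u1t u2t u2't.
    have := Flin x (W u1 0) q 1 u2 u2' (Wt _ _ u1t (tangent0 x)) u2t u2't.
    rewrite mul1r scale1r => E; rewrite /W; move: E.
    congr (F x _ = F x _ + F x _); apply/funext => r; rewrite /W;
      by case: (eqVneq r q) => [->|//]; rewrite eq_sym (negPf pq).
  have W0 u : tangent x u -> F x (W u u) = 0.
    move=> ut; apply: (Falt x _ p q (Wt _ _ ut ut) pq).
    by rewrite /W eqxx eqxx eq_sym (negPf pq).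
  have wp := wt p; have wq := wt q.
  have wpq := tangent_linear 1 wp wq; rewrite scale1r in wpq.
  have := W0 _ wpq.
  rewrite W1 // !W2 // !W0 // add0r addr0 => /eqP; rewrite addr_eq0 => /eqP E.
  have -> : F x w = F x (W (w p) (w q)).
    congr (F x _); apply/funext => r; rewrite /W; case: eqP => [->//|_].
    by case: eqP => [->|].
  rewrite E opprK; congr (F x _); apply/funext => r; rewrite /W.
  case: tpermP => [->|->|/eqP/negPf rp /eqP/negPf rq]; last by rewrite rp rq.
    by rewrite eqxx.
  by rewrite eq_sym (negPf pq) eqxx.
have [ts -> tsP] := prod_tpermP s.
elim: ts tsP v => [|[p q] ts IHts] /=.
  move=> _ v vt; rewrite big_nil odd_perm1 mul1r; congr (F x _).
  by apply/funext => r; rewrite perm1.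
case/andP=> pq tsP v vt; rewrite big_cons /= odd_mul_tperm pq signr_addb /=.
set u := (\prod_(j <- ts) _)%g.
have -> : (fun r => v ((tperm p q * u)%g r)) = (fun r => (v \o u) (tperm p q r)).
  by apply/funext => r; rewrite permM.
rewrite (swap (v \o u)) //; last by move=> r; exact: vt.
rewrite expr1 mulN1r mulNr; congr (- _); exact: IHts.
Qed.

Lemma form_frame_neq0 (e : 'I_n -> functional M) (v : 'I_l -> functional M) :
  (forall a, tangent x (e a)) ->
  (forall u, tangent x u -> exists c : 'I_n -> R, u = \sum_a c a *: e a) ->
  (forall s, tangent x (v s)) -> F x v != 0 ->
  exists k : {ffun 'I_l -> 'I_n}, F x (fun r => e (k r)) != 0.
Proof.
move=> et span vt Fv; apply: contrapT => /forallNP Fe; case/negP: Fv.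
have [Flin _ _] := F_form.
(* [m] bounds the slots that may hold arbitrary tangent vectors; the induction step expands the last
   such slot in the frame. *)
suff main m : forall w : 'I_l -> functional M, (forall s, tangent x (w s)) ->
    (forall s : 'I_l, (m <= s)%N -> exists a, w s = e a) -> F x w = 0.
  by apply/eqP; apply: (main l) => // s; rewrite leqNgt ltn_ord.
elim: m => [|m IHm] w wt wm.
  have [k kP] := choice (fun s => wm s isT).
  have := Fe (finfun k); rewrite (_ : (fun r => e (finfun k r)) = w) => [/negP|].
    by rewrite negbK => /eqP.
  by apply/funext => r; rewrite ffunE kP.
have [ml|lm] := ltnP m l; last first.
  by apply: IHm => // s ms; have := ltn_ord s; rewrite ltnNge (leq_trans lm ms).
pose r := Ordinal ml; have [c wr] := span _ (wt r).
pose L u := F x (fun s => if s == r then u else w s).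
have -> : F x w = L (w r).
  by congr (F x _); apply/funext => s; case: eqP => [->|].
rewrite wr (@tangent_linear_sum _ _ _ x) //; last by move=> a u u' ut u't; exact: Flin.
rewrite big1 // => a _; rewrite [L _]IHm ?mulr0 // => s; first by case: ifP.
move=> ms; case: (eqVneq s r) => [_|sr]; first by exists a.
apply: wm; rewrite ltn_neqAle ms andbT eq_sym.
by apply: contra sr => /eqP sm; apply/eqP/val_inj.
Qed.

End Forms.

(** * Complex-valued functions and the Leibniz rule for Clifford multiplication *)

Section ComplexDerivations.
Import numFieldTopology.Exports numFieldNormedType.Exports.
Variables (R : realType) (n : nat) (M : manifold R n).
Local Open Scope classical_set_scope.
Local Open Scope complex_scope.
Local Open Scope ring_scope.
Local Notation K := R[i].
Implicit Types (U : set M) (h : M -> K) (f : M -> R).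

Definition cderiv (v : functional M) h : K :=
  v (fun y => complex.Re (h y)) +i* v (fun y => complex.Im (h y)).

Lemma csmooth_on_sum U (I : Type) (r : seq I) (H : I -> M -> K) : open U ->
  (forall a, csmooth_on U (H a)) -> csmooth_on U (fun y => \sum_(a <- r) H a y).
Proof.
move=> Uo Hs; split.
  rewrite (_ : (fun y => complex.Re (\sum_(a <- r) H a y)) =
    fun y => \sum_(a <- r) complex.Re (H a y)); last first.
    by apply/funext => y; rewrite raddf_sum.
  by apply: smooth_on_sum => // a; have [] := Hs a.
rewrite (_ : (fun y => complex.Im (\sum_(a <- r) H a y)) =
  fun y => \sum_(a <- r) complex.Im (H a y)); last first.
  by apply/funext => y; rewrite raddf_sum.
by apply: smooth_on_sum => // a; have [] := Hs a.
Qed.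

Lemma csmooth_onZ U (c : K) h : open U -> csmooth_on U h ->
  csmooth_on U (fun y => c * h y).
Proof.
move=> Uo [hr hi]; case: c => p q; have sc b := smooth_on_cst U b.
split; rewrite /=.
  rewrite (_ : (fun y => complex.Re _) =
    fun y => p * complex.Re (h y) + (- q) * complex.Im (h y)).
    by apply: smooth_onD => //; exact: smooth_onM.
  by apply/funext => y; case: (h y) => a b /=; rewrite mulNr.
rewrite (_ : (fun y => complex.Im _) =
  fun y => p * complex.Im (h y) + q * complex.Re (h y)).
  by apply: smooth_onD => //; exact: smooth_onM.
by apply/funext => y; case: (h y) => a b /=.
Qed.

Lemma csmooth_onM U f h : open U -> smooth_on U f -> csmooth_on U h ->
  csmooth_on U (fun y => (f y)%:C * h y).
Proof.
move=> Uo fs [hr hi]; split.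
  rewrite (_ : (fun y => complex.Re _) = fun y => f y * complex.Re (h y)).
    exact: smooth_onM.
  by apply/funext => y; case: (h y) => a b /=; rewrite mul0r subr0.
rewrite (_ : (fun y => complex.Im _) = fun y => f y * complex.Im (h y)).
  exact: smooth_onM.
by apply/funext => y; case: (h y) => a b /=; rewrite mul0r addr0.
Qed.

Section AtPoint.
Variables (x : M) (v : functional M).
Hypothesis v_tangent : tangent x v.
Variable U : set M.
Hypothesis U_open : open U.
Hypothesis Ux : U x.

Lemma cderiv_sum (I : Type) (r : seq I) (H : I -> M -> K) :
  (forall a, csmooth_on U (H a)) ->
  cderiv v (fun y => \sum_(a <- r) H a y) = \sum_(a <- r) cderiv v (H a).
Proof.
move=> Hs; apply/eqP; rewrite eq_complex; apply/andP; split; apply/eqP; rewrite raddf_sum /=.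
  rewrite -(tangent_sum v_tangent U_open Ux); last by move=> a; have [] := Hs a.
  by congr v; apply/funext => y; rewrite raddf_sum.
rewrite -(tangent_sum v_tangent U_open Ux); last by move=> a; have [] := Hs a.
by congr v; apply/funext => y; rewrite raddf_sum.
Qed.

Lemma cderivZ (c : K) h : csmooth_on U h ->
  cderiv v (fun y => c * h y) = c * cderiv v h.
Proof.
move=> [hr hi]; case: c => p q; rewrite /cderiv.
have sM b k : smooth_on U k -> smooth_on U (fun y => b * k y).
  by move=> ks; apply: smooth_onM => //; exact: smooth_on_cst.
have E1 : v (fun y => complex.Re ((p +i* q) * h y)) =
    p * v (fun y => complex.Re (h y)) + - q * v (fun y => complex.Im (h y)).
  rewrite -!(tangentZ v_tangent U_open Ux) // -(tangentD v_tangent U_open Ux); [|exact: sM..].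
  by congr v; apply/funext => y; case: (h y) => a b /=; rewrite mulNr.
have E2 : v (fun y => complex.Im ((p +i* q) * h y)) =
    p * v (fun y => complex.Im (h y)) + q * v (fun y => complex.Re (h y)).
  rewrite -!(tangentZ v_tangent U_open Ux) // -(tangentD v_tangent U_open Ux); [|exact: sM..].
  by congr v; apply/funext => y; case: (h y) => a b /=.
by rewrite E1 E2 /= mulNr.
Qed.

Lemma cderivM f h : smooth_on U f -> csmooth_on U h ->
  cderiv v (fun y => (f y)%:C * h y) = (v f)%:C * h x + (f x)%:C * cderiv v h.
Proof.
move=> fs [hr hi]; rewrite /cderiv.
have E1 : v (fun y => complex.Re ((f y)%:C * h y)) =
    v f * complex.Re (h x) + f x * v (fun y => complex.Re (h y)).
  rewrite -(tangentM v_tangent U_open Ux) //.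
  by congr v; apply/funext => y; case: (h y) => a b /=; rewrite mul0r subr0.
have E2 : v (fun y => complex.Im ((f y)%:C * h y)) =
    v f * complex.Im (h x) + f x * v (fun y => complex.Im (h y)).
  rewrite -(tangentM v_tangent U_open Ux) //.
  by congr v; apply/funext => y; case: (h y) => a b /=; rewrite mul0r addr0.
rewrite E1 E2; case: (h x) => a b; apply/eqP; rewrite eq_complex /=.
by rewrite !mul0r !subr0 !addr0 !eqxx.
Qed.

(** Differentiation is entrywise and the matrices [gam a] are constant, so only the scalar Leibniz
    rule for a real function times a complex one is involved. *)
Lemma deriv_fiber_gamma (gam : 'I_n -> 'M[K]_(spin_dim n)) (f : 'I_n -> M -> R)
    (xi : M -> 'M[K]_(spin_dim n, 2)) :
  (forall a, smooth_on U (f a)) ->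
  (forall r s, csmooth_on U (fun y => xi y r s)) ->
  deriv_fiber v (fun y => (\sum_a (f a y)%:C *: gam a) *m xi y) =
    (\sum_a (v (f a))%:C *: gam a) *m xi x +
    (\sum_a (f a x)%:C *: gam a) *m deriv_fiber v xi.
Proof.
move=> fs xis; apply/matrixP => r s; rewrite [LHS]mxE -/(cderiv v _).
have E (c : 'I_n -> K) (u : 'M[K]_(spin_dim n, 2)) :
    ((\sum_a c a *: gam a) *m u) r s = \sum_q \sum_a c a * (gam a r q * u q s).
  rewrite mxE; apply: eq_bigr => q _; rewrite summxE mulr_suml.
  by apply: eq_bigr => a _; rewrite mxE mulrA.
have gs a q : csmooth_on U (fun y => gam a r q * xi y q s) by exact: csmooth_onZ.
have fgs a q : csmooth_on U (fun y => (f a y)%:C * (gam a r q * xi y q s)).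
  exact: csmooth_onM.
have -> : (fun y => ((\sum_a (f a y)%:C *: gam a) *m xi y) r s) =
    fun y => \sum_q \sum_a (f a y)%:C * (gam a r q * xi y q s).
  by apply/funext => y; rewrite E.
rewrite cderiv_sum => [|q]; last exact: csmooth_on_sum.
rewrite [RHS]mxE !E -big_split; apply: eq_bigr => q _ /=.
rewrite cderiv_sum // -big_split; apply: eq_bigr => a _ /=.
by rewrite cderivM // cderivZ // [deriv_fiber _ _ _ _]mxE.
Qed.

End AtPoint.
End ComplexDerivations.

(** * Clifford relations for vectors and the commutator of the spin connection form *)

Section CliffordAlgebra.
Variables (R : realType) (n t : nat).
Variable gam : 'I_n -> 'M[complex R]_(spin_dim n).
Hypothesis gam_cl : clifford_rep t gam.
Local Open Scope complex_scope.
Local Open Scope ring_scope.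
Local Notation K := R[i].

Lemma gamma_vec_anticomm (v w : 'rV[R]_n) :
  gamma_vec gam v *m gamma_vec gam w + gamma_vec gam w *m gamma_vec gam v =
    (- 2 * eta_form t v w)%:C%:M.
Proof.
rewrite /gamma_vec !mulmx_suml.
under eq_bigr do rewrite mulmx_sumr.
under [X in _ + X]eq_bigr do rewrite mulmx_sumr.
rewrite [X in _ + X]exchange_big -big_split /= /eta_form mulr_sumr.
rewrite !raddf_sum; apply: eq_bigr => a _; rewrite -big_split /=.
have E b : (v 0 a)%:C *: gam a *m ((w 0 b)%:C *: gam b) +
    (w 0 b)%:C *: gam b *m ((v 0 a)%:C *: gam a) =
    (if b == a then (- 2 * (eta R t a * v 0 a * w 0 a)) else 0)%:C%:M.
  rewrite -!scalemxAl -!scalemxAr !scalerA [X in _ + X *: _]mulrC -scalerDr.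
  rewrite gam_cl scale_scalar_mx -!rmorphM eq_sym; congr (_%:C%:M).
  by case: eqP => [->|_]; ring.
under eq_bigr do rewrite E.
by rewrite (bigD1 a) //= eqxx big1 ?addr0 // => b /negPf ->; rewrite !raddf0.
Qed.

Lemma gamma_vec_unit (v : 'rV[R]_n) :
  `|eta_form t v v| = 1 -> gamma_vec gam v \in unitmx.
Proof.
move=> v1; have q0 : (eta_form t v v)%:C != 0 :> K.
  by rewrite fmorph_eq0 -normr_eq0 v1 oner_neq0.
have sq : gamma_vec gam v *m gamma_vec gam v = (- (eta_form t v v)%:C)%:M.
  have two : (2 : K) != 0 by rewrite pnatr_eq0.
  apply: (scalerI two); rewrite scaler_nat mulr2n gamma_vec_anticomm.
  rewrite scale_scalar_mx; congr (_%:M).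
  by rewrite rmorphM rmorphN rmorph_nat mulNr mulrN.
apply: (proj1 (@mulmx1_unit _ _ _
  ((- (eta_form t v v)%:C)^-1 *: gamma_vec gam v) _)).
by rewrite -scalemxAr sq scale_scalar_mx mulVf // oppr_eq0.
Qed.

(** Invertibility of transition functions lets a test spinor take any value at a point. *)
Lemma spin_group_unit A : spin_group t gam A -> A \in unitmx.
Proof.
case=> vs [vs1 _ _ ->]; elim: vs vs1 => [|v vs IHvs] vs1.
  by rewrite big_nil unitmx1.
rewrite big_cons unitmx_mul gamma_vec_unit ?vs1 ?mem_head //=.
by apply: IHvs => w ws; apply: vs1; rewrite inE ws orbT.
Qed.

(* With [W a b = g(nabla e_a, e_b)], this is what makes Clifford multiplication
   parallel. *)
Lemma spin_form_comm (W : 'I_n -> 'I_n -> R) (c : 'I_n) :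
  (forall a b, W a b = - W b a) ->
  let om := 4%:R^-1 *: \sum_a \sum_b
    (eta R t a * eta R t b * W a b)%:C *: (gam a *m gam b) in
  om *m gam c + \sum_a (eta R t a * W a c)%:C *: gam a = gam c *m om.
Proof.
move=> Wanti /=; pose w a b : K := (eta R t a * eta R t b * W a b)%:C.
pose d a : K := (if a == c then 2 * eta R t c else 0)%:C.
have comm a : gam a *m gam c = - (gam c *m gam a) - (d a)%:M.
  have /(canRL (addrK _)) -> := gam_cl a c; rewrite addrC; congr (_ + _).
  rewrite -raddfN /= /d; congr (_%:M); case: eqP => [->|_]; rewrite -rmorphN //=.
    by rewrite mulNr.
  by rewrite mulr0 oppr0.
have E a b : gam a *m gam b *m gam c =
    gam c *m (gam a *m gam b) + d a *: gam b - d b *: gam a.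
  rewrite -mulmxA comm mulmxBr mulmxN (mulmxA (gam a)) comm mulmxBl mulNmx opprB.
  rewrite mul_scalar_mx mul_mx_scalar !mulmxA opprK [X in X - _ = _]addrC.
  by [].
pose s a : 'M[K]_(spin_dim n) := (eta R t a * W a c)%:C *: gam a.
(* Moving [gam c] past two factors leaves two contractions. Skewness of [W] makes the first the
   negative of the second, so their difference is -4 times the sum of [s]; this accounts for the 1/4
   in the spin connection. *)
have S1 : \sum_a \sum_b w a b *: (d a *: gam b) = (- 2)%:C *: \sum_b s b.
  rewrite (bigD1 c) //= [X in _ + X]big1 => [|a /negPf ac]; last first.
    by rewrite big1 // => b _; rewrite /d ac raddf0 scale0r scaler0.
  rewrite addr0 scaler_sumr; apply: eq_bigr => b _.
  rewrite /w /d /s eqxx !scalerA -!rmorphM.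
  congr (_%:C *: _); rewrite (Wanti c b).
  transitivity (- 2 * (eta R t c * eta R t c) * (eta R t b * W b c)); first by ring.
  by rewrite eta_sqr mulr1.
have S2 : \sum_a \sum_b w a b *: (d b *: gam a) = 2%:C *: \sum_a s a.
  rewrite scaler_sumr; apply: eq_bigr => a _.
  rewrite (bigD1 c) //= [X in _ + X]big1 => [|b /negPf bc]; last first.
    by rewrite /d bc raddf0 scale0r scaler0.
  rewrite addr0 /w /d /s eqxx !scalerA -!rmorphM.
  congr (_%:C *: _).
  transitivity (2 * (eta R t c * eta R t c) * (eta R t a * W a c)); first by ring.
  by rewrite eta_sqr mulr1.
have four : (4%:R : K) != 0 by rewrite pnatr_eq0.
apply: (scalerI four); rewrite scalerDr -scalemxAl -scalemxAr !scalerA mulfV // !scale1r.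
rewrite mulmx_suml mulmx_sumr.
under [X in X + _ = _]eq_bigr do rewrite mulmx_suml.
under [RHS]eq_bigr do rewrite mulmx_sumr.
have -> : \sum_a \sum_b ((eta R t a * eta R t b * W a b)%:C *: (gam a *m gam b)) *m gam c =
  (\sum_a \sum_b gam c *m (w a b *: (gam a *m gam b))) +
  (- 2)%:C *: \sum_b s b - 2%:C *: \sum_a s a.
  rewrite -S1 -S2 -big_split -sumrB; apply: eq_bigr => a _.
  rewrite -big_split -sumrB; apply: eq_bigr => b _ /=.
  by rewrite -scalemxAl E scalerBr scalerDr scalemxAr.
rewrite -[X in 4%:R *: X]/(\sum_a s a) -!addrA -scaleNr -!scalerDl.
have -> : (- 2)%:C + (- 2%:C + 4%:R) = 0 :> K by ring.
by rewrite scale0r addr0.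
Qed.

End CliffordAlgebra.

(** * The spin connection and the reduction of [Dhat_gamma] to its potential terms *)

Section SpinBundle.
Import numFieldTopology.Exports numFieldNormedType.Exports.
Variables (R : realType) (n t : nat) (M : manifold R n)
  (g : M -> functional M -> functional M -> R)
  (nab : (M -> functional M) -> (M -> functional M) -> M -> functional M)
  (gam : 'I_n -> 'M[complex R]_(spin_dim n)) (S : spin_structure t g gam).
Hypotheses (g_metric : pseudo_metric g) (nab_lc : levi_civita g nab)
  (gam_cl : clifford_rep t gam).
Local Open Scope classical_set_scope.
Local Open Scope complex_scope.
Local Open Scope ring_scope.
Local Notation K := R[i].
Local Notation fiber := 'M[K]_(spin_dim n, 2).

Lemma frame_tangent (i : gauge S) a x : gdom i x -> tangent x (frame i a x).
Proof. by have [+ _] := frame_field i a; exact. Qed.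

Lemma metric_sumr x v (c : 'I_n -> R) (e : 'I_n -> functional M) :
  tangent x v -> (forall a, tangent x (e a)) ->
  g x (\sum_a c a *: e a) v = \sum_a c a * g x (e a) v.
Proof.
move=> vt et; have [glin _ _ _] := g_metric.
by apply: (tangent_linear_sum (x := x) (L := fun u => g x u v)) => // *; exact: glin.
Qed.

Lemma frame_expansion (i : gauge S) x v : gdom i x -> tangent x v ->
  v = \sum_a (eta R t a * g x v (frame i a x)) *: frame i a x.
Proof.
move=> ix vt; have [c vE] := frame_span ix vt.
rewrite {1}vE; apply: eq_bigr => a _; congr (_ *: _).
have et b := frame_tangent b ix.
rewrite vE metric_sumr // (bigD1 a) //= big1 => [|b ba]; last first.
  by rewrite frame_orthonormal // (negPf ba) mulr0.
by rewrite frame_orthonormal // eqxx addr0 mulrCA eta_sqr mulr1.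
Qed.

Lemma clifford_gamma_vec (i : gauge S) x v :
  clifford i x v = gamma_vec gam (\row_a (eta R t a * g x v (frame i a x))).
Proof. by apply: eq_bigr => a _; rewrite mxE. Qed.

Lemma clifford_frame (i : gauge S) x a : gdom i x ->
  clifford i x (frame i a x) = gam a.
Proof.
move=> ix; rewrite /clifford (bigD1 a) //= big1 => [|b ba]; last first.
  by rewrite frame_orthonormal // eq_sym (negPf ba) mulr0 raddf0 scale0r.
by rewrite frame_orthonormal // eqxx eta_sqr addr0 scale1r.
Qed.

(** The scalar stays anonymous: sufficiency multiplies it by zero, and necessity computes it for a
    single frame vector. *)
Lemma clifford_anticomm (i : gauge S) x v w : exists k : K,
  clifford i x v *m clifford i x w + clifford i x w *m clifford i x v = k%:M.
Proof. by rewrite !clifford_gamma_vec (gamma_vec_anticomm gam_cl); eexists. Qed.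

Section Leibniz.
Variables (U : set M) (Z : M -> functional M) (i : gauge S) (x : M).
Hypotheses (U_open : open U) (Z_field : vector_field U Z) (Ux : U x)
  (ix : gdom i x).
Let V := U `&` gdom i.
Let Vo : open V. Proof. exact: openI U_open (gdom_open i). Qed.
Let Vx : V x. Proof. by []. Qed.
Let VU : V `<=` U. Proof. by move=> y []. Qed.
Let ZV : vector_field V Z. Proof. exact: vector_fieldS Z_field. Qed.
Let eV a : vector_field V (frame i a).
Proof. by apply: vector_fieldS (frame_field i a) => y []. Qed.
Let Zx : tangent x (Z x). Proof. by case: Z_field => + _; exact. Qed.
Local Notation W a b := (g x (nab Z (frame i a) x) (frame i b x)).
Let nab_tangent Y : vector_field V Y -> tangent x (nab Z Y x).
Proof. by move=> YV; have [+ _] := lc_field nab_lc Vo ZV YV; exact. Qed.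

(** Metric compatibility applied to [g(e_a, e_b)], which is constant on the gauge domain. *)
Lemma connection_form_skew a b : W a b = - W b a.
Proof.
have [_ gsym _ gsm] := g_metric.
have := lc_metric nab_lc Vo ZV (eV a) (eV b) Vx.
rewrite -(tangent_eq Zx Vo Vx (f := fun=> if a == b then eta R t a else 0)); last first.
- by move=> y [_ iy]; rewrite frame_orthonormal.
- exact: smooth_on_cst.
rewrite (tangent_cst Zx Vo Vx) => /esym/eqP; rewrite addr_eq0 => /eqP ->.
by rewrite gsym //; [exact: frame_tangent | exact: nab_tangent].
Qed.

(** Metric compatibility again; the sum arises from expanding [X] in the frame inside
    [g(X, nabla_Z e_a)]. *)
Lemma frame_component_deriv (X : M -> functional M) a : vector_field V X ->
  Z x (fun y => eta R t a * g y (X y) (frame i a y)) =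
    eta R t a * g x (nab Z X x) (frame i a x) +
    \sum_b (eta R t b * g x (X x) (frame i b x)) * (eta R t a * W a b).
Proof.
move=> XV; have [_ gsym _ gsm] := g_metric.
have Xx : tangent x (X x) by have [+ _] := XV; exact.
rewrite (tangentZ Zx Vo Vx); last exact: gsm (eV a).
rewrite (lc_metric nab_lc Vo ZV XV (eV a) Vx) mulrDr; congr (_ + _).
have nt := nab_tangent (eV a).
rewrite {1}(frame_expansion ix Xx) metric_sumr //; last by move=> b; exact: frame_tangent.
rewrite mulr_sumr; apply: eq_bigr => b _; rewrite mulrCA; congr (_ * (_ * _)).
by rewrite gsym //; exact: frame_tangent.
Qed.

Lemma nabla_spin_clifford (X : M -> functional M) (Xi : gauge S -> M -> fiber) :
  vector_field U X -> spinor_field U Xi ->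
  nabla_spin nab Z (fun j y => clifford j y (X y) *m Xi j y) i x =
    clifford i x (nab Z X x) *m Xi i x +
    clifford i x (X x) *m nabla_spin nab Z Xi i x.
Proof.
move=> XU [Xis _]; have XV := vector_fieldS VU XU.
have [_ _ _ gsm] := g_metric.
rewrite /nabla_spin [deriv_fiber _ _](deriv_fiber_gamma Zx Vo Vx); last 2 first.
- by move=> a; apply: smooth_onM => //; [exact: smooth_on_cst | exact: gsm].
- exact: Xis.
rewrite (mulmxDr (clifford i x (X x))) addrAC [RHS]addrA [RHS]addrAC.
congr (_ + _).
rewrite !mulmxA -!mulmxDl; congr (_ *m _).
under eq_bigr do rewrite (frame_component_deriv _ XV) rmorphD scalerDl.
rewrite big_split /= -/(clifford i x (nab Z X x)) -addrA; congr (_ + _).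
under eq_bigr do rewrite rmorph_sum scaler_suml.
rewrite exchange_big /= /clifford mulmx_sumr mulmx_suml -big_split.
apply: eq_bigr => c _ /=; rewrite -scalemxAl.
(* The terms from differentiating the components of [X] are exactly the commutator of the spin
   connection form with [gam c]. *)
rewrite -(spin_form_comm gam_cl (W := fun a b => W a b) c connection_form_skew).
rewrite scalerDr addrC scalemxAr; congr (_ + _).
by rewrite scaler_sumr; apply: eq_bigr => a _; rewrite scalerA -rmorphM.
Qed.

Lemma Dhat_gammaE (A AC : potential S) X Xi :
  vector_field U X -> spinor_field U Xi ->
  Dhat_gamma nab A AC Z X Xi i x =
    A i x (Z x) (clifford i x (X x) *m Xi i x) +
    clifford i x (X x) *m AC i x (Z x) (Xi i x).
Proof.
move=> XU XiU; rewrite /Dhat_gamma /connection nabla_spin_clifford //.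
move: (nabla_spin _ _ _ _ _) => N /=; rewrite mulmxDr mulmxN opprD opprK.
move: (clifford i x (nab Z X x) *m _) (_ *m N) (A _ _ _ _) (_ *m AC _ _ _ _).
move=> a b c d; rewrite [a + b + c]addrC -!addrA [- a + _]addrA -opprD.
by rewrite (addrA a) addNKr.
Qed.

End Leibniz.
End SpinBundle.

Lemma trmx_scale (F : pzSemiRingType) m p (c : F) (A : 'M[F]_(m, p)) :
  (c *: A)^T = c *: A^T.
Proof. exact: linearZ. Qed.

Lemma gamma_skew_sum_tr (R : realType) (n t : nat)
    (gam : 'I_n -> 'M[complex R]_(spin_dim n)) (gam_cl : clifford_rep t gam)
    (C : 'M[complex R]_(spin_dim n)) (Delta : nat -> int)
    (Delta_signs : charge_signs gam C Delta) (l : nat) (c : complex R)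
    (f : {ffun 'I_l -> 'I_n} -> complex R) :
  (c *: \sum_k f k *: gamma_skew gam k)^T *m C =
    (Delta 0 * Delta l)%:~R *: (C *m (c *: \sum_k f k *: gamma_skew gam k)).
Proof.
rewrite (trmx_scale c) -scalemxAl -scalemxAr scalerA mulrC -scalerA.
congr (_ *: _); rewrite [(\sum_a _)^T]raddf_sum /= mulmx_suml mulmx_sumr scaler_sumr.
apply: eq_bigr => k _; rewrite (trmx_scale (f k)) -scalemxAl -scalemxAr.
by rewrite (gamma_skew_tr gam_cl Delta_signs) !scalerA mulrC.
Qed.

Lemma mxtrace_mulmx_inj (F : fieldType) m p (A B : 'M[F]_(m, p)) :
  (forall X : 'M_(p, m), \tr (A *m X) = \tr (B *m X)) -> A = B.
Proof.
have E (D : 'M[F]_(m, p)) r s : \tr (D *m delta_mx s r) = D r s.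
  rewrite mxtrace_mulC /mxtrace (bigD1 s) //= big1 => [|q /negPf qs].
    rewrite mxE (bigD1 r) //= big1 => [|q /negPf qr]; last first.
      by rewrite mxE qr andbF mul0r.
    by rewrite mxE !eqxx mul1r !addr0.
  by rewrite mxE big1 // => k _; rewrite mxE qs mul0r.
by move=> AB; apply/matrixP => r s; rewrite -!E AB.
Qed.

(** Here [P] stands for the form, [c] and [d] for two Clifford vectors, and [s] for the sign of the
    adjoint. The terms regroup as [P] times the anticommutator plus [s] times the anticommutator
    times [P], and a scalar commutes with [P]. *)
Lemma anticommutator_cancel (F : fieldType) N m (P c d : 'M[F]_N)
    (xi : 'M_(N, m)) (Q : 'M_m) (s k : F) :
  c *m d + d *m c = k%:M ->
  (P *m c *m (d *m xi) *m Q + d *m ((s *: (c *m P)) *m xi *m Q)) +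
  (P *m d *m (c *m xi) *m Q + c *m ((s *: (d *m P)) *m xi *m Q)) =
    (1 + s) *: (k *: (P *m xi *m Q)).
Proof.
move=> cd.
have E u v : P *m u *m (v *m xi) *m Q = P *m (u *m v) *m xi *m Q.
  by rewrite !mulmxA.
have E' u v : v *m (s *: (u *m P) *m xi *m Q) = s *: ((v *m u) *m P *m xi *m Q).
  by rewrite -!scalemxAl -scalemxAr !mulmxA.
rewrite !E !E' addrACA -scalerDr -!mulmxDl -mulmxDr [d *m c + _]addrC cd.
by rewrite mul_scalar_mx mul_mx_scalar -!scalemxAl scalerDl scale1r.
Qed.

(** * Adjoints with respect to the twisted charge conjugation *)

Section Adjoint.
Variables (R : realType) (n : nat).
Local Open Scope complex_scope.
Local Open Scope ring_scope.
Local Notation K := R[i].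
Local Notation fiber := 'M[K]_(spin_dim n, 2).
Variables (C : 'M[K]_(spin_dim n)) (T : 'M[K]_2).

(** In trace form, cyclicity lets endomorphisms of both tensor factors be moved across the pairing
    by matrix algebra. *)
Lemma charge2E (zeta xi : fiber) :
  charge2 C T zeta xi = \tr (T^T *m zeta^T *m C *m xi).
Proof.
rewrite /charge2 exchange_big /mxtrace; apply: eq_bigr => b _ /=.
rewrite -!mulmxA mxE; apply: eq_bigr => a _; rewrite mxE; congr (_ * _).
rewrite /charge -mulmxA !mxE; apply: eq_bigr => r _.
rewrite !mxE; congr (_ * _); apply: eq_bigr => s _; by rewrite !mxE.
Qed.

Lemma adjoint_unique (Phi P1 P2 : fiber -> fiber) zeta :
  C \in unitmx -> T \in unitmx ->
  is_adjoint C T Phi P1 -> is_adjoint C T Phi P2 -> P1 zeta = P2 zeta.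
Proof.
move=> Cu Tu a1 a2; apply: trmx_inj.
have Ttu : T^T \in unitmx by rewrite unitmx_tr.
apply: (can_inj (mulKmx Ttu)); apply: (can_inj (mulmxK Cu)) => /=.
by apply: mxtrace_mulmx_inj => X; have := a1 zeta X; rewrite -(a2 zeta X) !charge2E.
Qed.

(** The spinor factor contributes [p] and the Pauli factor [q]; [B] is scaled in advance so that
    they cancel. *)
Lemma tensor_act_adjoint (A B : 'M[K]_(spin_dim n)) (Q : 'M[K]_2) (p q : K) :
  B^T *m C = p *: (C *m A) -> T^T *m Q = q *: (Q^T *m T^T) -> p * q = 1 ->
  is_adjoint C T (tensor_act A Q) (tensor_act B Q).
Proof.
move=> BC TQ pq zeta xi; rewrite !charge2E /tensor_act !trmx_mul trmxK.
have -> : T^T *m (Q *m (zeta^T *m B^T)) *m C *m xi =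
    (T^T *m Q) *m zeta^T *m (B^T *m C) *m xi by rewrite !mulmxA.
rewrite BC TQ -!scalemxAr -!scalemxAl !scalerA pq scale1r.
have -> : T^T *m zeta^T *m C *m (A *m xi *m Q^T) =
    (T^T *m zeta^T *m (C *m A) *m xi) *m Q^T by rewrite !mulmxA.
by rewrite [RHS]mxtrace_mulC !mulmxA.
Qed.

Lemma tensor_act_eq0 (A : 'M[K]_(spin_dim n)) (Q : 'M[K]_2) :
  Q \in unitmx -> (forall xi, tensor_act A Q xi = 0) -> A = 0.
Proof.
move=> Qu AQ0; apply/matrixP => r s.
have := AQ0 (delta_mx s 0) => /(congr1 (fun X => X *m invmx Q^T)).
rewrite /tensor_act mulmxK ?unitmx_tr // mul0mx => /matrixP/(_ r 0).
rewrite !mxE (bigD1 s) //= big1 => [|q /negPf qs]; rewrite !mxE ?eqxx.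
  by rewrite mulr1 addr0.
by rewrite qs mulr0.
Qed.

End Adjoint.

(** One sign comes from transposing [tau j], the other from moving it past [tau i]; the
    transposition sign of [tau i] appears on both sides. *)
Lemma tau_adjoint_sign (R : realType) (i j : 'I_4) :
  (tau R i)^T *m tau R j =
    (tau_sym j * tau_comm i j)%:~R *: ((tau R j)^T *m (tau R i)^T).
Proof.
rewrite !tau_tr -!scalemxAl -!scalemxAr tau_mulC !scalerA -!rmorphM.
congr (_%:~R *: _).
by case: i j => -[|[|[|[|//]]]] ? [[|[|[|[|//]]]] ?].
Qed.

(** * The admissibility criterion in both directions *)

Section Admissible.
Import numFieldTopology.Exports numFieldNormedType.Exports.
Variables (R : realType) (n t : nat) (M : manifold R n)
  (g : M -> functional M -> functional M -> R)
  (nab : (M -> functional M) -> (M -> functional M) -> M -> functional M)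
  (gam : 'I_n -> 'M[complex R]_(spin_dim n)) (S : spin_structure t g gam).
Hypotheses (n_gt0 : (0 < n)%N) (g_metric : pseudo_metric g)
  (nab_lc : levi_civita g nab) (gam_cl : clifford_rep t gam).
Local Open Scope classical_set_scope.
Local Open Scope complex_scope.
Local Open Scope ring_scope.
Local Notation K := R[i].
Local Notation fiber := 'M[K]_(spin_dim n, 2).
Variables (C : 'M[K]_(spin_dim n)) (C_charge : charge_conjugation t gam C)
  (Delta : nat -> int) (Delta_signs : charge_signs gam C Delta).
Variables (l : nat) (F : M -> ('I_l -> functional M) -> R).
Hypothesis F_form : diff_form F.

(** Source of test spinors: constancy up to [trans i i] in the gauge [i], with compatibility across
    gauges supplied by the cocycle condition. *)
Lemma constant_spinor_field (i : gauge S) (xi : fiber) :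
  spinor_field (gdom i) (fun j x => trans j i x *m xi).
Proof.
split=> [j r s|j k x ix jx kx]; last by rewrite mulmxA trans_cocycle.
have Uo : open (gdom i `&` gdom j) by apply: openI; exact: gdom_open.
have -> : (fun x => (trans j i x *m xi) r s) =
    fun x => \sum_q xi q s * trans j i x r q.
  by apply/funext => x; rewrite mxE; apply: eq_bigr => q _; rewrite mulrC.
apply: csmooth_on_sum => // q; apply: csmooth_onZ => //.
by rewrite setIC; exact: trans_smooth.
Qed.

Lemma form_clifford_neq0 (x : M) (v : 'I_l -> functional M) (i : gauge S) :
  gdom i x -> (forall s, tangent x (v s)) -> F x v != 0 ->
  form_clifford F i x != 0.
Proof.
move=> ix vt Fv.
have et a := frame_tangent a ix.
have [k Fk] := form_frame_neq0 F_form et (fun u => frame_span ix) vt Fv.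
apply: contra Fk => /eqP; rewrite /form_clifford => /eqP.
rewrite scaler_eq0 invr_eq0 pnatr_eq0 eqn0Ngt fact_gt0 /= => /eqP sum0.
(* [P] is the factor that raises the indices. It is a sign and is invariant under reordering, so [c]
   inherits the skewness of [F] and vanishes only where [F] does. *)
pose P (k : {ffun 'I_l -> 'I_n}) := \prod_r eta R t (k r).
pose c (k : {ffun 'I_l -> 'I_n}) := (F x (fun r => frame i (k r) x) * P k)%:C.
have c0 (k' : {ffun 'I_l -> 'I_n}) : ~~ injectiveb k' -> c k' = 0.
  move=> /injectivePn[r [s rs krs]]; rewrite /c.
  by have [_ Falt _] := F_form; rewrite (Falt x _ r s) ?mul0r ?krs.
have cs (k' : {ffun 'I_l -> 'I_n}) (s : 'S_l) :
    c [ffun r => k' (s r)] = (-1) ^+ s * c k'.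
  rewrite -(rmorph_sign (real_complex R)) -rmorphM /c; congr (_%:C).
  rewrite mulrA -(form_perm F_form s (fun r => et (k' r))); congr (_ * _).
    by congr (F x _); apply/funext => r; rewrite ffunE.
  rewrite /P [RHS](reindex_inj (@perm_inj _ s)) /=.
  by apply: eq_bigr => r _; rewrite ffunE.
have := gamma_skew_free gam_cl c0 cs sum0 k.
move/eqP; rewrite fmorph_eq0 mulf_eq0 => /orP[//|/eqP P0].
have : P k * P k = 1.
  by rewrite /P -big_split /= big1 // => r _; exact: eta_sqr.
by rewrite P0 mul0r => /eqP; rewrite eq_sym oner_eq0.
Qed.

Lemma form_clifford_tr (i : gauge S) x :
  (form_clifford F i x)^T *m C =
    (Delta 0 * Delta l)%:~R *: (C *m form_clifford F i x).
Proof.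
exact: (gamma_skew_sum_tr gam_cl Delta_signs _
  (fun k => (F x (fun r => frame i (k r) x) * \prod_r eta R t (k r))%:C)).
Qed.

Lemma clifford_tr (i : gauge S) x v :
  (clifford i x v)^T *m C = (Delta 0 * Delta 1)%:~R *: (C *m clifford i x v).
Proof.
rewrite /clifford [(\sum_a _)^T]raddf_sum /= mulmx_suml mulmx_sumr scaler_sumr.
apply: eq_bigr => a _; rewrite (trmx_scale (_%:C)) -scalemxAl -scalemxAr.
by rewrite (gam_tr gam_cl Delta_signs) !scalerA mulrC.
Qed.

Variables (a b : 'I_4).
Let sg : int := Delta l * Delta 1 * tau_sym b * tau_comm a b.
Local Notation A := (form_potential (S := S) F (tau R b)).
Local Notation Phi := (form_clifford F).

Definition form_potential_adjoint : potential S := fun i x v =>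
  tensor_act (sg%:~R *: (clifford i x v *m Phi i x)) (tau R b).

Lemma sg_sqr : sg * sg = 1.
Proof.
rewrite /sg /tau_sym /tau_comm.
have [[] -> _] := Delta_signs l; have [[] -> _] := Delta_signs 1%N;
  by do 2 case: ifP => _.
Qed.

Lemma form_potential_adjointP i x v :
  is_adjoint C (tau R a) (A i x v) (form_potential_adjoint i x v).
Proof.
(* Transposing the form and the vector gives [Delta 0 * Delta l] and [Delta 0 * Delta 1], in which
   [Delta 0] squares to 1. By the definition of [sg] both numbers supplied here are the same sign,
   so their product is 1. *)
apply: (@tensor_act_adjoint _ _ _ _ _ _ _ (sg * (Delta 1 * Delta l))%:~R
  (tau_sym b * tau_comm a b)%:~R _ (tau_adjoint_sign R a b)).
  rewrite (trmx_scale (sg%:~R)) -scalemxAl trmx_mul -mulmxA clifford_tr.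
  rewrite -scalemxAr (mulmxA _ C).
  rewrite form_clifford_tr -scalemxAl -mulmxA !scalerA -!rmorphM.
  congr (_%:~R *: _); transitivity (sg * (Delta 1 * Delta l) * (Delta 0 * Delta 0)).
    by ring.
  by rewrite (Delta_sqr Delta_signs) mulr1.
have -> : tau_sym b * tau_comm a b = sg * (Delta 1 * Delta l).
  have [D1 Dl] := (Delta_sqr Delta_signs 1, Delta_sqr Delta_signs l).
  transitivity ((Delta 1 * Delta 1) * (Delta l * Delta l) *
    (tau_sym b * tau_comm a b)); first by rewrite D1 Dl !mul1r.
  by rewrite /sg; ring.
rewrite -rmorphM mulrACA sg_sqr mul1r mulrACA.
by rewrite !(Delta_sqr Delta_signs) mulr1.
Qed.

Lemma form_potential_sum i x (v w : functional M) xi (k : K) :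
  clifford i x v *m clifford i x w + clifford i x w *m clifford i x v = k%:M ->
  let G u u' := A i x u (clifford i x u' *m xi) +
    clifford i x u' *m form_potential_adjoint i x u xi in
  G v w + G w v =
    (1 + sg)%:~R *: (k *: tensor_act (Phi i x) (tau R b) xi).
Proof.
move=> kE G.
rewrite rmorphD; exact: anticommutator_cancel.
Qed.

Lemma admissible_if : sg = -1 -> admissible nab C (tau R a) A.
Proof.
move=> sg1; exists form_potential_adjoint; split.
  by move=> i x v _ _; exact: form_potential_adjointP.
move=> U X Y Xi Uo XU YU XiU i x Ux ix.
rewrite !(Dhat_gammaE g_metric nab_lc gam_cl (U := U)) //.
have [k /(form_potential_sum (Xi i x))] := clifford_anticomm gam_cl i x (X x) (Y x).
rewrite /= sg1 subrr scale0r => /eqP; rewrite addr_eq0 => /eqP; exact.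
Qed.

Lemma admissible_only_if :
  form_nonzero F -> admissible nab C (tau R a) A -> sg = -1.
Proof.
move=> [x [v [vt Fv]]] [AC [ACP adm]].
(* A single non-null direction suffices: both vector fields are taken to be the frame vector
   [r0]. *)
have [i ix] := gdom_cover S x; pose r0 := Ordinal n_gt0.
pose e := frame i r0; have eU := frame_field i r0.
have Cu := charge_unit C_charge.
have tu := spin_group_unit gam_cl (trans_spin ix ix).
apply: contraTeq (form_clifford_neq0 ix vt Fv) => sg1; rewrite negbK; apply/eqP.
have sg0 : (1 + sg)%:~R != 0 :> K.
  by rewrite intr_eq0 addrC addr_eq0.
(* The test field has the value [trans i i x *m xi] at [x], so the vanishing is proved for the form
   times this invertible matrix. *)
apply: (can_inj (mulmxK tu)); rewrite mul0mx.
apply: (tensor_act_eq0 (tau_unit R b)) => xi.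
pose Xi j y := trans j i y *m xi.
have XiU : spinor_field (gdom i) Xi := constant_spinor_field i xi.
have := adm _ _ _ _ (gdom_open i) eU eU XiU i x ix ix.
rewrite (Dhat_gammaE g_metric nab_lc gam_cl (gdom_open i) eU ix ix _ _ eU XiU).
have et := frame_tangent r0 ix.
rewrite (adjoint_unique _ Cu (tau_unit R a) (ACP i x _ ix et)
  (form_potential_adjointP i x (e x))).
move=> /eqP; rewrite -addr_eq0.
have kE := gam_cl r0 r0; rewrite -(clifford_frame r0 ix) in kE.
rewrite (form_potential_sum (Xi i x) kE) !scaler_eq0 (negPf sg0) eqxx /=.
rewrite fmorph_eq0 mulf_eq0 oppr_eq0 pnatr_eq0 /= => /orP[/eqP eta0|/eqP <-].
  by have := eta_sqr R t r0; rewrite eta0 mul0r => /eqP; rewrite eq_sym oner_eq0.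
by rewrite /tensor_act /Xi !mulmxA.
Qed.

End Admissible.

Theorem theorem3 (R : realType) (n t : nat) (n_gt0 : (0 < n)%N)
    (t_le_n : (t <= n)%N) (M : manifold R n)
    (g : M -> functional M -> functional M -> R) (g_metric : pseudo_metric g)
    (nab : (M -> functional M) -> (M -> functional M) -> M -> functional M)
    (nab_lc : levi_civita g nab)
    (gam : 'I_n -> 'M[complex R]_(spin_dim n)) (gam_cl : clifford_rep t gam)
    (S : spin_structure t g gam)
    (C : 'M[complex R]_(spin_dim n)) (C_charge : charge_conjugation t gam C)
    (Delta : nat -> int) (Delta_signs : charge_signs gam C Delta)
    (eps2 : 'I_4 -> 'I_4 -> int) (eps2_signs : commutation_signs R eps2)
    (eps : 'I_4 -> int) (eps_signs : transposition_signs R eps)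
    (i j : 'I_4) (l : nat) :
  (forall F : M -> ('I_l -> functional M) -> R,
     diff_form F -> form_nonzero F ->
     (admissible nab C (tau R i) (form_potential (S := S) F (tau R j)) <->
      Delta l * Delta 1%N * eps j * eps2 i j = -1)) /\
  ((l <= n)%N ->
     (Delta l * Delta 1%N * eps j * eps2 i j = -1 <->
      (((l%:Z = 1 %[mod 4])%Z \/
        (l%:Z = 1 - Delta 0%N * Delta 1%N %[mod 4])%Z) /\
       (j : nat) \in js_first i) \/
      (((l%:Z = 3 %[mod 4])%Z \/
        (l%:Z = 1 + Delta 0%N * Delta 1%N %[mod 4])%Z) /\
       (j : nat) \in js_second i))).
Proof.
rewrite (transposition_signsE j eps_signs) (commutation_signsE i j eps2_signs).
split=> [F F_form F_neq0|ln].
  split; first exact: (admissible_only_if n_gt0 g_metric nab_lc gam_cl C_charge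
    Delta_signs F_form F_neq0).
  exact: (admissible_if S g_metric nab_lc gam_cl Delta_signs).
have pm k : Delta k = 1 \/ Delta k = -1 by have [] := Delta_signs k.
have d1 : Delta 0 * Delta 1 = 1 \/ Delta 0 * Delta 1 = -1.
  by case: (pm 0%N) (pm 1%N) => -> [] ->; auto.
(* The congruence classes become the value of [Delta l * Delta 1] and the tables that of [y]; a
   product of two signs is -1 exactly when they differ. *)
have [-> ->] := charge_sign_classes d1
  (DeltaE gam_cl C_charge Delta_signs n_gt0 ln).
rewrite js_firstE js_secondE -mulrA; set y := tau_sym j * _.
have y1 : y = 1 \/ y = -1.
  by rewrite /y /tau_sym /tau_comm; do 2 case: ifP => _; auto.
by case: (pm l) (pm 1%N) y1 => -> [] -> [] ->; split; lia.
Qed.
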